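(* (Expansion of the energy in terms of action variables) Let $\alpha\in[0,1)$, $0<\beta_0<\beta_1<1$, $0<e_0<e_1<1$, $U_0:=[(-\beta_1,-\beta_0)\cup(\beta_0,\beta_1)]\times(e_0,e_1)$, and suppose $\mu_1>0$ is sufficiently small such that the map $\mathcal J_\alpha:(0,\mu_1)\times U_0\to\mathbb R^3$, $(\mu,\beta,e)\mapsto(j_1,j_2,j_3)$, is injective. Then $$\varepsilon=1-\frac1{2j_3^2}-\frac3{j_2j_3^3}+\frac{15}{8j_3^4}+\frac{2\alpha j_1}{j_2^3j_3^3}+\mathcal O(\mu^6)$$ for all $(j_1,j_2,j_3)$ lying in the image of $\mathcal J_\alpha$, where $\varepsilon$ and $\mu$ are the values corresponding to $(j_1,j_2,j_3)=\mathcal J_\alpha(\mu,\beta,e)$.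
   Context: Dimensionless description of bound timelike geodesics in the Kerr exterior ($\alpha=a_H/M_H$ rotation parameter, $\varepsilon=E/m$ energy, $\lambda=L/(M_Hm)$ with $L^2$ the Carter constant, $\lambda_z=L_z/(M_Hm)=\beta\lambda+\alpha\varepsilon$ azimuthal angular momentum, $x=r/M_H$). For $\beta\in(-1,1)$, $x>x_+:=1+\sqrt{1-\alpha^2}$, $\lambda>0$: $w_{\alpha,\beta,\lambda}(x)=\frac{\alpha\beta\lambda}{x^2}+\sqrt{(1-\frac2x+\frac{\alpha^2}{x^2})(1+\frac{\lambda^2}{x^2})}$. There is $\lambda_{ms}(\alpha,\beta)>0$ such that $w_{\alpha,\beta,\lambda}$ has no critical point for $0<\lambda<\lambda_{ms}$, while for $\lambda>\lambda_{ms}$ it has exactly two critical points, a local maximum $x_{max}$ and a local minimum $x_{min}>x_{max}$; write $\varepsilon_{max}=w_{\alpha,\beta,\lambda}(x_{max})$, $\varepsilon_{min}=w_{\alpha,\beta,\lambda}(x_{min})$. Let $\mathcal D_\alpha:=\{(\beta,\lambda,\varepsilon):-1<\beta<1,\lambda>\lambda_{ms}(\alpha,\beta),\varepsilon_{min}<\varepsilon<\min\{1,\varepsilon_{max}\}\}$. For $(\beta,\lambda,\varepsilon)\in\mathcal D_\alpha$ the turning points are the two solutions $x_1<x_2$ of $w_{\alpha,\beta,\lambda}(x)=\varepsilon$ in $(x_{max},\infty)$; $p>0$ and $e\in(0,1)$ are defined by $x_1=\frac p{1+e}$, $x_2=\frac p{1-e}$. The map $(\beta,\lambda,\varepsilon)\mapsto(\beta,p,e)$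 is a bijection from $\mathcal D_\alpha$ onto a set $\mathcal E_\alpha=\{-1<\beta<1,0<e<1,p>p_{ISO}(\alpha,\beta,e)\}$, so $\varepsilon,\lambda$ may be regarded as functions of $(\beta,p,e)\in\mathcal E_\alpha$. Put $\mu:=1/\sqrt p$; for $(\beta,e)\in U_0$ and $\mu>0$ small enough one has $(\beta,\mu^{-2},e)\in\mathcal E_\alpha$. Action variables: with $\mathcal R(x)=(\varepsilon x^2-\alpha\beta\lambda)^2-(x^2-2x+\alpha^2)(x^2+\lambda^2)$ and $k(\vartheta)=(\frac{\lambda_z}{\sin\vartheta}-\alpha\varepsilon\sin\vartheta)^2+\alpha^2\cos^2\vartheta$, and $\vartheta_1<\vartheta_2$ the solutions of $k(\vartheta)=\lambda^2$ in $(0,\pi)$, $j_1:=\lambda_z$, $\;j_2:=|\lambda_z|+\frac1\pi\int_{\vartheta_1}^{\vartheta_2}\sqrt{\lambda^2-k(\vartheta)}\,d\vartheta$, $\;j_3:=j_2+\frac1\pi\int_{x_1}^{x_2}\frac{\sqrt{\mathcal R(x)}}{x^2-2x+\alpha^2}\,dx$. (That is, $j_1=I_1/(M_Hm)$, $j_2=(|I_1|+I_2)/(M_Hm)$, $j_3=(|I_1|+I_2+I_3)/(M_Hm)$ for the action variables $I_1,I_2,I_3$ of the azimuthal, polar and radial motion.) $\mathcal J_\alpha$ is injective on $(0,\mu_1)\times U_0$ for $\mu_1>0$ small enough. $\mathcal O(\mu^n)$ is understood as $\mu\to0$, uniformly for $(\beta,e)\in U_0$. *)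

(* Defs.v *)
From Stdlib Require Export Reals ClassicalEpsilon.
From Coquelicot Require Export Coquelicot.
Open Scope R_scope.

(* Everything is dimensionless: radii in units of M_H, energies in units of m,
   angular momenta in units of M_H m.  Throughout, [al] is the rotation
   parameter, [lam ^ 2] the Carter constant, [eps] the energy, and [be] the
   parameter in lambda_z = be lam + al eps. *)

Definition horizon (al : R) : R := 1 + sqrt (1 - al ^ 2).

Definition w (al be lam x : R) : R :=
  al * be * lam / x ^ 2
  + sqrt ((1 - 2 / x + al ^ 2 / x ^ 2) * (1 + lam ^ 2 / x ^ 2)).

Definition critical_point (al be lam x : R) : Prop :=
  horizon al < x /\ is_derive (w al be lam) x 0.

Definition local_max (f : R -> R) (x : R) : Prop :=
  locally x (fun y => f y <= f x).

Definition local_min (f : R -> R) (x : R) : Prop :=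
  locally x (fun y => f x <= f y).

Definition two_critical_points (al be lam xmax xmin : R) : Prop :=
  xmax < xmin /\
  (forall x, critical_point al be lam x <-> x = xmax \/ x = xmin) /\
  local_max (w al be lam) xmax /\
  local_min (w al be lam) xmin.

(* This determines [lms] uniquely. *)
Definition is_lambda_ms (al be lms : R) : Prop :=
  0 < lms /\
  (forall lam, 0 < lam < lms -> forall x, ~ critical_point al be lam x) /\
  (forall lam, lms < lam ->
     exists xmax xmin, two_critical_points al be lam xmax xmin).

(* The set D_al of parameters (be, lam, eps) of bound orbits. *)
Definition bound_orbit (al be lam eps : R) : Prop :=
  -1 < be < 1 /\
  (exists lms, is_lambda_ms al be lms /\ lms < lam) /\
  (exists xmax xmin, two_critical_points al be lam xmax xmin /\
     w al be lam xmin < eps < Rmin 1 (w al be lam xmax)).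

Definition turning_points (al be lam eps x1 x2 : R) : Prop :=
  exists xmax xmin, two_critical_points al be lam xmax xmin /\
    xmax < x1 < x2 /\
    (forall x, xmax < x -> (w al be lam x = eps <-> x = x1 \/ x = x2)).

(* The graph of the map (be, lam, eps) |-> (be, p, e) on D_al. *)
Definition orbit (al be p e lam eps : R) : Prop :=
  bound_orbit al be lam eps /\ 0 < p /\ 0 < e < 1 /\
  turning_points al be lam eps (p / (1 + e)) (p / (1 - e)).

(* The image E_al of that map. *)
Definition E_set (al be p e : R) : Prop :=
  exists lam eps, orbit al be p e lam eps.

(* The inverse map on E_al; its values off E_al are irrelevant. *)
Definition lam_eps (al be p e : R) : R * R :=
  epsilon (inhabits (0, 0)) (fun q => orbit al be p e (fst q) (snd q)).

Definition lam_of (al be p e : R) : R := fst (lam_eps al be p e).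
Definition eps_of (al be p e : R) : R := snd (lam_eps al be p e).

Definition radial_R (al be lam eps x : R) : R :=
  (eps * x ^ 2 - al * be * lam) ^ 2
  - (x ^ 2 - 2 * x + al ^ 2) * (x ^ 2 + lam ^ 2).

Definition polar_k (al eps lamz th : R) : R :=
  (lamz / sin th - al * eps * sin th) ^ 2 + al ^ 2 * cos th ^ 2.

Definition polar_turning_points (al lam eps lamz : R) : R * R :=
  epsilon (inhabits (0, 0)) (fun t =>
    0 < fst t < snd t /\ snd t < PI /\
    forall th, 0 < th < PI ->
      (polar_k al eps lamz th = lam ^ 2 <-> th = fst t \/ th = snd t)).

Definition polar_action (al lam eps lamz : R) : R :=
  let t := polar_turning_points al lam eps lamz in
  / PI * RInt (fun th => sqrt (lam ^ 2 - polar_k al eps lamz th))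
              (fst t) (snd t).

Definition radial_action (al be lam eps x1 x2 : R) : R :=
  / PI * RInt (fun x => sqrt (radial_R al be lam eps x)
                        / (x ^ 2 - 2 * x + al ^ 2)) x1 x2.

Definition J (al : R) (q : R * R * R) : R * R * R :=
  let '(mu, be, e) := q in
  let p := / mu ^ 2 in
  let lam := lam_of al be p e in
  let eps := eps_of al be p e in
  let lamz := be * lam + al * eps in
  let j1 := lamz in
  let j2 := Rabs lamz + polar_action al lam eps lamz in
  let j3 := j2 + radial_action al be lam eps (p / (1 + e)) (p / (1 - e)) in
  (j1, j2, j3).

Definition U0 (be0 be1 e0 e1 be e : R) : Prop :=
  (- be1 < be < - be0 \/ be0 < be < be1) /\ e0 < e < e1.

Definition J_domain (be0 be1 e0 e1 mu1 : R) (q : R * R * R) : Prop :=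
  let '(mu, be, e) := q in 0 < mu < mu1 /\ U0 be0 be1 e0 e1 be e.

(* Main.v *)
Require Import Defs.
From Stdlib Require Import Psatz.

(* Write m = 1/sqrt p, E = 1 - e^2, k = 1 - eps^2. The turning points are two
   roots of the quartic R, and Vieta's relations give k = E m^2 (1 + O(m^2)),
   lam^2 m^2 = 1 - 2 al be m + O(m^2) and a factorization
   R = k (x2 - x)(x - x1)(x^2 - s x + q) with s = 2 - 4 al be m + O(m^2), q = O(1).
   Up to O(m^3), j2 is the square root of the coefficient of -x^2 in R. Expanding
   sqrt (x^2 - s x + q) / (x^2 - 2 x + al^2) to second order in 1/x reduces the
   radial action to two Kepler integrals, and
     j3 = 1/sqrt k + sqrt k ((2 + s/2)/sqrt E - 2) + O(m^3).
   Inserting this and eps = 1 - k/2 - k^2/8 + O(m^6) cancels all terms below m^6. *)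

(** * Integrals with an arcsine primitive *)

(** [lam] and [eps] are given only through the choice of an orbit and are never solved for. Crude
    bounds at the inner turning point start a bootstrap: inserted in the Vieta relations they yield
    the leading terms, and these yield the next order. The accuracy needed is dictated by the size
    of the actions: [j3] is of size [1 / m], so an error [O(m^3)] in it moves [1 / (2 j3^2)] by
    [O(m^6)]. As a summand of [j3], [j2] needs the same accuracy; in the other terms relative errors
    [O(m^2)] suffice, and [O(m)] in the spin term. Each asymptotic estimate is an exact identity
    that displays the error as a sum of products of quantities of known order. Uniformity in [be]
    and [e] then only requires denominators bounded away from zero: [e < e1 < 1] does this for
    [sqrt E], while [be0] keeps lambda_z nonzero for small [m], as the polar factorization
    requires. *)

Lemma is_RInt_primitive_interior (F f : R -> R) (a b : R) :
  a < b ->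
  (forall x, a <= x <= b -> continuous f x) ->
  (forall x, a <= x <= b -> continuous F x) ->
  (forall x, a < x < b -> is_derive F x (f x)) ->
  is_RInt f a b (F b - F a).
Proof.
  intros Hab Hf HF Hd.
  (* The arcsine primitives below reach the arguments [-1] and [1] at the end points, where they
     need not be differentiable. Extending [f] continuously to the line gives an integral that is
     differentiable everywhere, to be compared with [F] on the open interval. *)
  destruct (C0_extension_le f a b) as [g [Hg Hgf]]; [exact Hf|].
  assert (HI : forall x, is_RInt g a x (RInt g a x)).
  { intros x. apply (RInt_correct g a x), ex_RInt_continuous.
    intros z _. apply Hg. }
  assert (HG : forall x, is_derive (RInt g a) x (g x)).
  { intros x. apply (is_derive_RInt g (RInt g a) a x); [|apply Hg].
    apply filter_forall. exact HI. }
  destruct (MVT_gen (fun x => F x - RInt g a x) a b (fun _ => 0)) as [c [_ Hc]].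
  - rewrite Rmin_left, Rmax_right by lra. intros x Hx.
    replace 0 with (minus (f x) (g x))
      by (rewrite Hgf by lra; apply (minus_eq_zero (f x))).
    apply (is_derive_minus F (RInt g a)); [apply Hd; lra | apply HG].
  - rewrite Rmin_left, Rmax_right by lra. intros x Hx.
    apply continuity_pt_filterlim.
    apply (continuous_minus F (RInt g a)); [apply HF; lra|].
    apply (ex_derive_continuous (RInt g a)). exists (g x). apply HG.
  - rewrite (RInt_point a g) in Hc. change (@zero _) with 0 in Hc.
    replace (F b - F a) with (RInt g a b) by lra.
    apply (is_RInt_ext g); [|apply HI].
    rewrite Rmin_left, Rmax_right by lra. intros x Hx. apply Hgf. lra.
Qed.

Lemma is_derive_asin (x : R) : -1 < x < 1 -> is_derive asin x (/ sqrt (1 - x ^ 2)).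
Proof.
  intros Hx. apply is_derive_Reals.
  replace (/ sqrt (1 - x ^ 2)) with (derive_pt asin x (derivable_pt_asin x Hx)).
  - destruct (derivable_pt_asin x Hx) as [l Hl]. exact Hl.
  - rewrite derive_pt_asin, Rsqr_pow2. unfold Rdiv. ring.
Qed.

Lemma continuous_asin_1 : continuous asin 1.
Proof.
  apply filterlim_locally. intros eps.
  (* The lower bound [0] matters only for large [eps]; it keeps [t] in the range where [sin]
     increases. *)
  set (t := Rmax 0 (PI / 2 - eps / 2)).
  pose proof PI_RGT_0 as HPI. pose proof (cond_pos eps) as Heps.
  assert (Ht0 : 0 <= t) by apply Rmax_l.
  assert (Hte : PI / 2 - eps < t).
  { apply Rlt_le_trans with (PI / 2 - eps / 2); [lra | apply Rmax_r]. }
  assert (Ht : t < PI / 2) by (apply Rmax_lub_lt; lra).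
  assert (Hs : sin t < 1) by (rewrite <- sin_PI2; apply sin_increasing_1; lra).
  assert (Hs0 : 0 <= sin t) by (apply sin_ge_0; lra).
  assert (Hd : 0 < 1 - sin t) by lra.
  exists (mkposreal _ Hd). intros y Hy.
  change (Rabs (y - 1) < 1 - sin t) in Hy. apply Rabs_def2 in Hy.
  change (Rabs (asin y - asin 1) < eps). rewrite asin_1.
  pose proof (asin_bound y) as Hb.
  assert (Hlow : t < asin y).
  { apply Rnot_le_lt. intros Hle. destruct (Rle_lt_dec y 1) as [Hy1 | Hy1].
    - assert (sin (asin y) <= sin t) by (apply sin_incr_1; lra).
      rewrite sin_asin in H by lra. lra.
    (* Beyond [1] the function [asin] is constant, equal to [PI / 2]. *)
    - revert Hle. unfold asin. destruct (Rle_dec y (-1)); [lra|].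
      destruct (Rle_dec 1 y); lra. }
  apply Rabs_def1; lra.
Qed.

Lemma continuous_asin (x : R) : -1 <= x <= 1 -> continuous asin x.
Proof.
  intros Hx. destruct (Req_dec x 1) as [-> | H1]; [apply continuous_asin_1|].
  destruct (Req_dec x (-1)) as [-> | H2].
  - apply (continuous_ext (fun y => opp (asin (- y)))).
    { intros y. rewrite asin_opp. apply Ropp_involutive. }
    apply (continuous_opp (fun y => asin (- y))).
    apply (continuous_comp Ropp asin).
    + apply (continuous_opp (fun y : R => y)), continuous_id.
    + replace (- -1) with 1 by ring. apply continuous_asin_1.
  - apply (ex_derive_continuous asin). eexists. apply is_derive_asin. lra.
Qed.

(** The square root in the derivative is passed as a positive number [y] with the right square, so
    that it can be named as a quotient of known radicals instead of being simplified. *)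
Lemma is_derive_asin_comp (phi : R -> R) (x dphi y : R) :
  is_derive phi x dphi -> 0 < y -> y ^ 2 = 1 - phi x ^ 2 ->
  is_derive (fun t => asin (phi t)) x (dphi / y).
Proof.
  intros Hphi Hy Hy2.
  replace (dphi / y) with (scal dphi (/ sqrt (1 - phi x ^ 2))).
  - apply (is_derive_comp asin phi); [apply is_derive_asin; nra | exact Hphi].
  - rewrite <- Hy2, sqrt_pow2 by lra. reflexivity.
Qed.

Lemma continuous_asin_comp (phi : R -> R) (x : R) :
  continuous phi x -> -1 <= phi x <= 1 -> continuous (fun t => asin (phi t)) x.
Proof.
  intros Hphi Hx. apply (continuous_comp phi asin); [exact Hphi|].
  apply continuous_asin, Hx.
Qed.

(** * Kepler integrals between two apsides *)

Section KeplerIntegrals.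

Context (x1 x2 g : R) (Hx1 : 0 < x1) (Hx12 : x1 < x2)
  (Hg : 0 < g) (Hg2 : g ^ 2 = x1 * x2).

(** For a Kepler ellipse with apsidal distances [x1] and [x2], [c] is the semi-major axis, [g] the
    semi-minor axis and [r] the distance from centre to focus. *)
Let c := (x1 + x2) / 2.
Let r := (x2 - x1) / 2.
Let f x := sqrt ((x2 - x) * (x - x1)).

Lemma apsidal_sqrt_pos x : x1 < x < x2 -> 0 < f x.
Proof. intros Hx. apply sqrt_lt_R0. nra. Qed.

Lemma apsidal_sqrt_sqr x : x1 <= x <= x2 -> f x ^ 2 = (x2 - x) * (x - x1).
Proof. intros Hx. apply pow2_sqrt. nra. Qed.

Lemma apsidal_sqrt_continuous x : continuous f x.
Proof.
  apply (continuous_sqrt_comp (fun x => (x2 - x) * (x - x1))).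
  apply (ex_derive_continuous (fun x => (x2 - x) * (x - x1))). auto_derive. exact I.
Qed.

Lemma apsidal_sqrt_derive x : x1 < x < x2 -> is_derive f x ((c - x) / f x).
Proof.
  intros Hx. pose proof (apsidal_sqrt_pos x Hx) as Hf. unfold f in *. auto_derive; [nra|].
  unfold c. replace (x2 + - x) with (x2 - x) by ring. replace (x + - x1) with (x - x1) by ring.
  field. lra.
Qed.

Lemma asin_affine_derive x : x1 < x < x2 ->
  is_derive (fun t => asin ((t - c) / r)) x (/ f x).
Proof.
  intros Hx. pose proof (apsidal_sqrt_pos x Hx) as Hf. pose proof (apsidal_sqrt_sqr x ltac:(lra)) as Hf2.
  replace (/ f x) with (/ r / (f x / r)) by (field; unfold r; lra).
  apply (is_derive_asin_comp (fun t => (t - c) / r)).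
  - auto_derive; [trivial|]. unfold r; field. lra.
  - apply Rdiv_lt_0_compat; unfold r; lra.
  - replace ((f x / r) ^ 2) with (f x ^ 2 / r ^ 2) by (field; unfold r; lra).
    rewrite Hf2. unfold c, r. field. lra.
Qed.

(** The argument is [(c - g^2 / t) / r], affine in [1 / t], with values [-1] at [x1] and [1] at
    [x2]: the inversion that makes [1 / (x f)] an arcsine integrand. *)
Lemma asin_homographic_derive x : x1 < x < x2 ->
  is_derive (fun t => asin ((c * t - g ^ 2) / (r * t))) x (g / (x * f x)).
Proof.
  intros Hx. pose proof (apsidal_sqrt_pos x Hx) as Hf. pose proof (apsidal_sqrt_sqr x ltac:(lra)) as Hf2.
  assert (Hr : 0 < r) by (unfold r; lra).
  replace (g / (x * f x)) with (g ^ 2 / (r * x ^ 2) / (g * f x / (r * x)))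
    by (field; repeat split; lra).
  apply (is_derive_asin_comp (fun t => (c * t - g ^ 2) / (r * t))).
  - auto_derive; [nra|]. field. lra.
  - apply Rdiv_lt_0_compat; nra.
  - replace ((g * f x / (r * x)) ^ 2) with (g ^ 2 * f x ^ 2 / (r * x) ^ 2) by (field; lra).
    rewrite Hf2, Hg2. unfold c, r. field. lra.
Qed.

Lemma asin_affine_continuous x : x1 <= x <= x2 -> continuous (fun t => asin ((t - c) / r)) x.
Proof.
  intros Hx. apply (continuous_asin_comp (fun t => (t - c) / r)).
  - apply (ex_derive_continuous (fun t => (t - c) / r)). auto_derive. trivial.
  - split; apply (Rmult_le_reg_r r); unfold r; try lra; unfold c; field_simplify; lra.
Qed.

Lemma asin_homographic_continuous x : x1 <= x <= x2 ->
  continuous (fun t => asin ((c * t - g ^ 2) / (r * t))) x.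
Proof.
  intros Hx. assert (Hr : 0 < r) by (unfold r; lra).
  apply (continuous_asin_comp (fun t => (c * t - g ^ 2) / (r * t))).
  - apply (ex_derive_continuous (fun t => (c * t - g ^ 2) / (r * t))). auto_derive. nra.
  - assert (0 < r * x) by nra.
    assert (Hq : (c * x - g ^ 2) / (r * x) * (r * x) = c * x - g ^ 2) by (field; lra).
    rewrite Hg2 in *. unfold c, r in *.
    split; apply (Rmult_le_reg_r ((x2 - x1) / 2 * x)); try lra; rewrite Hq; nra.
Qed.

(** Since [f^2 = - x^2 + 2 c x - g^2], the integrand splits as [(c - x) / f + c / f - g^2 / (x f)].
    The primitive [f] of the first term vanishes at both ends and each arcsine gains [PI]. *)
Lemma is_RInt_kepler1 : is_RInt (fun x => f x / x) x1 x2 (PI * (c - g)).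
Proof.
  set (F x := f x + c * asin ((x - c) / r) - g * asin ((c * x - g ^ 2) / (r * x))).
  replace (PI * (c - g)) with (F x2 - F x1).
  2:{ unfold F, f. rewrite Hg2.
      replace ((x2 - x2) * (x2 - x1)) with 0 by ring.
      replace ((x2 - x1) * (x1 - x1)) with 0 by ring.
      replace ((x2 - c) / r) with 1 by (unfold c, r; field; lra).
      replace ((x1 - c) / r) with (Ropp 1) by (unfold c, r; field; lra).
      replace ((c * x2 - x1 * x2) / (r * x2)) with 1 by (unfold c, r; field; lra).
      replace ((c * x1 - x1 * x2) / (r * x1)) with (Ropp 1) by (unfold c, r; field; lra).
      rewrite asin_opp, asin_1. field. }
  apply is_RInt_primitive_interior; [assumption | | |].
  - intros x Hx. apply (continuous_mult f Rinv); [apply apsidal_sqrt_continuous|].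
    apply continuous_Rinv. lra.
  - intros x Hx. unfold F.
    apply (continuous_minus (fun x => f x + c * asin ((x - c) / r)) (fun x => g * asin ((c * x - g ^ 2) / (r * x)))).
    + apply (continuous_plus f (fun x => c * asin ((x - c) / r))); [apply apsidal_sqrt_continuous|].
      apply (continuous_scal_r c (fun x => asin ((x - c) / r))), asin_affine_continuous, Hx.
    + apply (continuous_scal_r g (fun x => asin ((c * x - g ^ 2) / (r * x)))), asin_homographic_continuous, Hx.
  - intros x Hx. pose proof (apsidal_sqrt_pos x Hx) as Hf. pose proof (apsidal_sqrt_sqr x ltac:(lra)) as Hf2.
    replace (f x / x) with ((c - x) / f x + c * / f x - g * (g / (x * f x))).
    2:{ replace (f x / x) with (f x ^ 2 / (x * f x)) by (field; lra).
        replace (g * (g / (x * f x))) with (g ^ 2 / (x * f x)) by (field; lra).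
        rewrite Hf2, Hg2. unfold c. field. lra. }
    apply (is_derive_minus (fun x => f x + c * asin ((x - c) / r)) (fun x => g * asin ((c * x - g ^ 2) / (r * x)))).
    + apply (is_derive_plus f (fun x => c * asin ((x - c) / r))); [apply apsidal_sqrt_derive, Hx|].
      apply (is_derive_scal (fun x => asin ((x - c) / r))), asin_affine_derive, Hx.
    + apply (is_derive_scal (fun x => asin ((c * x - g ^ 2) / (r * x)))), asin_homographic_derive, Hx.
Qed.

(** Integration by parts: the integrand is the derivative of [- f / x] plus [(c - x) / (x f)], and
    the latter is [c / (x f) - 1 / f]. *)
Lemma is_RInt_kepler2 : is_RInt (fun x => f x / x ^ 2) x1 x2 (PI * (c / g - 1)).
Proof.
  set (F x := c / g * asin ((c * x - g ^ 2) / (r * x)) - asin ((x - c) / r) - f x * / x).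
  replace (PI * (c / g - 1)) with (F x2 - F x1).
  2:{ unfold F, f. rewrite Hg2.
      replace ((x2 - x2) * (x2 - x1)) with 0 by ring.
      replace ((x2 - x1) * (x1 - x1)) with 0 by ring.
      replace ((x2 - c) / r) with 1 by (unfold c, r; field; lra).
      replace ((x1 - c) / r) with (Ropp 1) by (unfold c, r; field; lra).
      replace ((c * x2 - x1 * x2) / (r * x2)) with 1 by (unfold c, r; field; lra).
      replace ((c * x1 - x1 * x2) / (r * x1)) with (Ropp 1) by (unfold c, r; field; lra).
      rewrite asin_opp, asin_1, sqrt_0. field. lra. }
  assert (Hinv : forall x, x1 <= x <= x2 -> continuous Rinv x).
  { intros x Hx. apply continuous_Rinv. lra. }
  apply is_RInt_primitive_interior; [assumption | | |].
  - intros x Hx. apply (continuous_mult f (fun x => / x ^ 2)); [apply apsidal_sqrt_continuous|].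
    apply (ex_derive_continuous (fun x => / x ^ 2)). auto_derive. nra.
  - intros x Hx. unfold F.
    apply (continuous_minus (fun x => c / g * asin ((c * x - g ^ 2) / (r * x)) - asin ((x - c) / r)) (fun x => f x * / x)).
    + apply (continuous_minus (fun x => c / g * asin ((c * x - g ^ 2) / (r * x))) (fun x => asin ((x - c) / r))).
      * apply (continuous_scal_r (c / g) (fun x => asin ((c * x - g ^ 2) / (r * x)))), asin_homographic_continuous, Hx.
      * apply asin_affine_continuous, Hx.
    + apply (continuous_mult f Rinv); [apply apsidal_sqrt_continuous | apply Hinv, Hx].
  - intros x Hx. pose proof (apsidal_sqrt_pos x Hx) as Hf. pose proof (apsidal_sqrt_sqr x ltac:(lra)) as Hf2.
    replace (f x / x ^ 2) with (c / g * (g / (x * f x)) - / f x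
       - ((c - x) / f x * / x + f x * (- 1 / x ^ 2))).
    2:{ replace (f x * (-1 / x ^ 2)) with (- (f x ^ 2 / (x ^ 2 * f x))) by (field; lra).
        replace (f x / x ^ 2) with (f x ^ 2 / (x ^ 2 * f x)) by (field; lra).
        rewrite Hf2. unfold c. field. lra. }
    apply (is_derive_minus (fun x => c / g * asin ((c * x - g ^ 2) / (r * x)) - asin ((x - c) / r)) (fun x => f x * / x)).
    + apply (is_derive_minus (fun x => c / g * asin ((c * x - g ^ 2) / (r * x))) (fun x => asin ((x - c) / r))).
      * apply (is_derive_scal (fun x => asin ((c * x - g ^ 2) / (r * x)))), asin_homographic_derive, Hx.
      * apply asin_affine_derive, Hx.
    + apply (is_derive_mult f Rinv); [apply apsidal_sqrt_derive, Hx | | apply Rmult_comm].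
      change (is_derive (fun t => / t) x (- 1 / x ^ 2)).
      auto_derive; [lra | field; lra].
Qed.
End KeplerIntegrals.

(** * The model polar integral *)

Section PolarIntegral.

Context (s0 : R) (Hs0 : 0 < s0 < 1).

Let C := sqrt (1 - s0 ^ 2).
Let th0 := asin s0.

Lemma polar_cos_pos : 0 < C.
Proof. apply sqrt_lt_R0. nra. Qed.

Lemma polar_cos_sqr : C ^ 2 = 1 - s0 ^ 2.
Proof. apply pow2_sqrt. nra. Qed.

Lemma sin_polar_angle : sin th0 = s0.
Proof. apply sin_asin. lra. Qed.

Lemma cos_polar_angle : cos th0 = C.
Proof. unfold th0. rewrite cos_asin, Rsqr_pow2 by lra. reflexivity. Qed.

Lemma polar_angle_bound : 0 < th0 < PI / 2.
Proof.
  split; [|apply asin_bound_lt; lra].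
  apply Rnot_le_lt. intros H. pose proof (asin_bound s0) as Hb.
  assert (Hs : sin th0 <= sin 0) by (pose proof PI_RGT_0; apply sin_incr_1; unfold th0 in *; lra).
  rewrite sin_polar_angle, sin_0 in Hs. lra.
Qed.

Lemma polar_cos_bound th : th0 <= th <= PI - th0 -> - C <= cos th <= C.
Proof.
  intros Hth. pose proof polar_angle_bound. rewrite <- cos_polar_angle, <- Rtrigo_facts.cos_pi_minus.
  split; apply cos_decr_1; lra.
Qed.

Lemma polar_cos_bound_lt th : th0 < th < PI - th0 -> - C < cos th < C.
Proof.
  intros Hth. pose proof polar_angle_bound. rewrite <- cos_polar_angle, <- Rtrigo_facts.cos_pi_minus.
  split; apply cos_decreasing_1; lra.
Qed.

Lemma polar_sin_pos th : th0 <= th <= PI - th0 -> 0 < sin th.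
Proof. intros Hth. pose proof polar_angle_bound. apply sin_gt_0; lra. Qed.

Lemma sin_pow2 th : sin th ^ 2 = 1 - cos th ^ 2.
Proof. pose proof (sin2_cos2 th). rewrite !Rsqr_pow2 in H. lra. Qed.

(** With [D] the square root, [D / sin = sin / D - s0^2 / (sin D)]; the two terms come from
    [- asin (cos / C)] and [s0 asin (s0 cot / C)]. Up to the factor [1 / PI], this is the polar
    action of free motion on a sphere with total momentum [1] and azimuthal momentum [s0]. *)
Lemma is_RInt_polar :
  is_RInt (fun th => sqrt (sin th ^ 2 - s0 ^ 2) / sin th) th0 (PI - th0) (PI * (1 - s0)).
Proof.
  pose proof polar_angle_bound as Hth0. pose proof polar_cos_pos as HC. pose proof polar_cos_sqr as HC2.
  set (F th := s0 * asin (s0 * cos th / (C * sin th)) - asin (cos th / C)).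
  assert (Hcmp : forall th, th0 <= th <= PI - th0 -> (s0 * cos th) ^ 2 <= (C * sin th) ^ 2).
  { intros th Hth. pose proof (polar_cos_bound th Hth). pose proof (sin_pow2 th).
    rewrite !Rpow_mult_distr, H0, HC2. nra. }
  replace (PI * (1 - s0)) with (F (PI - th0) - F th0).
  2:{ unfold F. rewrite Rtrigo_facts.cos_pi_minus, Rtrigo_facts.sin_pi_minus, sin_polar_angle, cos_polar_angle.
      replace (- C / C) with (Ropp 1) by (field; lra).
      replace (C / C) with 1 by (field; lra).
      replace (s0 * C / (C * s0)) with 1 by (field; lra).
      replace (s0 * - C / (C * s0)) with (Ropp 1) by (field; lra).
      rewrite asin_opp, asin_1. field. }
  apply is_RInt_primitive_interior; [lra | | |].
  - intros th Hth. pose proof (polar_sin_pos th Hth).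
    apply (continuous_mult (fun th => sqrt (sin th ^ 2 - s0 ^ 2)) (fun th => / sin th)).
    + apply (continuous_sqrt_comp (fun th => sin th ^ 2 - s0 ^ 2)).
      apply (ex_derive_continuous (fun th => sin th ^ 2 - s0 ^ 2)). auto_derive. trivial.
    + apply (ex_derive_continuous (fun th => / sin th)). auto_derive. lra.
  - intros th Hth. pose proof (polar_sin_pos th Hth). pose proof (polar_cos_bound th Hth) as Hc.
    pose proof (Hcmp th Hth) as Hcm. unfold F.
    apply (continuous_minus (fun th => s0 * asin (s0 * cos th / (C * sin th))) (fun th => asin (cos th / C))).
    + apply (continuous_scal_r s0 (fun th => asin (s0 * cos th / (C * sin th)))).
      apply (continuous_asin_comp (fun th => s0 * cos th / (C * sin th))).
      * apply (ex_derive_continuous (fun th => s0 * cos th / (C * sin th))). auto_derive. nra.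
      * assert (0 < C * sin th) by nra.
        assert (Hq : s0 * cos th / (C * sin th) * (C * sin th) = s0 * cos th) by (field; lra).
        split; apply (Rmult_le_reg_r (C * sin th)); try lra; rewrite Hq; nra.
    + apply (continuous_asin_comp (fun th => cos th / C)).
      * apply (ex_derive_continuous (fun th => cos th / C)). auto_derive. lra.
      * assert (Hq : cos th / C * C = cos th) by (field; lra).
        split; apply (Rmult_le_reg_r C); try lra; rewrite Hq; lra.
  - intros th Hth. pose proof (polar_sin_pos th ltac:(lra)) as Hs.
    pose proof (polar_cos_bound_lt th Hth) as Hc. pose proof (sin_pow2 th) as Hsc.
    set (D := sqrt (sin th ^ 2 - s0 ^ 2)).
    assert (HD : 0 < D) by (apply sqrt_lt_R0; nra).
    assert (HD2 : D ^ 2 = sin th ^ 2 - s0 ^ 2) by (apply pow2_sqrt; nra).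
    replace (D / sin th) with
      (s0 * (- (s0 / (C * sin th ^ 2)) / (D / (C * sin th))) - (- sin th / C) / (D / C)).
    2:{ replace (D / sin th) with (D ^ 2 / (D * sin th)) by (field; lra).
        rewrite HD2. field. lra. }
    apply (is_derive_minus (fun th => s0 * asin (s0 * cos th / (C * sin th))) (fun th => asin (cos th / C))).
    + apply (is_derive_scal (fun th => asin (s0 * cos th / (C * sin th)))).
      apply (is_derive_asin_comp (fun th => s0 * cos th / (C * sin th))).
      * auto_derive; [nra|].
        replace (- (s0 / (C * sin th ^ 2)))
          with (- s0 * (sin th ^ 2 + cos th ^ 2) / (C * sin th ^ 2))
          by (replace (sin th ^ 2 + cos th ^ 2) with 1 by lra; field; lra).
        field. lra.
      * apply Rdiv_lt_0_compat; nra.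
      * replace ((D / (C * sin th)) ^ 2) with (D ^ 2 / (C * sin th) ^ 2) by (field; lra).
        replace (1 - (s0 * cos th / (C * sin th)) ^ 2) with
          ((C ^ 2 * sin th ^ 2 - s0 ^ 2 * cos th ^ 2) / (C * sin th) ^ 2) by (field; lra).
        rewrite HD2, HC2, Hsc. f_equal. ring.
    + apply (is_derive_asin_comp (fun th => cos th / C)).
      * auto_derive; [lra|]. field. lra.
      * apply Rdiv_lt_0_compat; lra.
      * replace ((D / C) ^ 2) with (D ^ 2 / C ^ 2) by (field; lra).
        replace (1 - (cos th / C) ^ 2) with ((C ^ 2 - cos th ^ 2) / C ^ 2) by (field; lra).
        rewrite HD2, HC2, Hsc. f_equal. ring.
Qed.
End PolarIntegral.

(** * The polar action *)

Lemma sin_eq_iff (s0 th : R) :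
  0 < s0 < 1 -> 0 < th < PI ->
  (sin th = s0 <-> th = asin s0 \/ th = PI - asin s0).
Proof.
  intros Hs0 Hth. split.
  - intros H. destruct (Rle_lt_dec th (PI / 2)) as [Hle | Hlt].
    + left. rewrite <- H, asin_sin; lra.
    + right. rewrite <- H, <- Rtrigo_facts.sin_pi_minus, asin_sin; lra.
  - intros [-> | ->]; rewrite ?Rtrigo_facts.sin_pi_minus; apply sin_asin; lra.
Qed.

(** The solution set and the order of the entries determine the pair, so [epsilon] can only pick
    this one. *)
Lemma polar_turning_points_eq (al lam eps lamz t1 t2 : R) :
  0 < t1 < t2 -> t2 < PI ->
  (forall th, 0 < th < PI ->
     (polar_k al eps lamz th = lam ^ 2 <-> th = t1 \/ th = t2)) ->
  polar_turning_points al lam eps lamz = (t1, t2).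
Proof.
  intros H12 H2 Hk. unfold polar_turning_points.
  match goal with |- epsilon ?i ?P = _ =>
    assert (HP : P (epsilon i P)) by
      (apply epsilon_spec; exists (t1, t2); simpl; auto);
    destruct (epsilon i P) as [a b] end.
  simpl in HP. destruct HP as [Hab [Hb Hk']].
  assert (Ha1 : a = t1 \/ a = t2) by (apply Hk, Hk'; [lra | lra | now left]).
  assert (Hb1 : b = t1 \/ b = t2) by (apply Hk, Hk'; [lra | lra | now right]).
  f_equal; lra.
Qed.

(* With y = sin^2 th, lam^2 - k(th) = (a y^2 + N y - lamz^2) / y = (y - s0^2)(a y + M) / y, where
   s0^2 is the positive root and M = lamz^2 / s0^2; the factor a y + M lies in [M, M + a]. *)
Lemma polar_action_bounds (al lam eps lamz : R) :
  let N := lam ^ 2 + 2 * al * eps * lamz - al ^ 2 in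
  let a := al ^ 2 * (1 - eps ^ 2) in
  eps ^ 2 <= 1 -> lamz <> 0 -> (lamz - al * eps) ^ 2 < lam ^ 2 -> 0 < N ->
  sqrt N <= Rabs lamz + polar_action al lam eps lamz <= sqrt N + a / sqrt N.
Proof.
  intros N a Heps Hz Hlam HN.
  assert (Ha : 0 <= a) by (unfold a; nra).
  assert (Hz2 : 0 < lamz ^ 2) by nra.
  (* [a + N - lamz^2] is the value of [lam^2 - k] at the equator; its positivity is what forces
     [s0 < 1]. *)
  assert (HaN : lamz ^ 2 < a + N) by (unfold a, N; nra).
  (* [M] is the positive root of [M^2 = N M + a lamz^2]. Solving for [M] rather than for [s0^2]
     avoids dividing by [a], which vanishes when [al = 0]. *)
  set (Q := sqrt (N ^ 2 + 4 * a * lamz ^ 2)).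
  assert (HQ2 : Q ^ 2 = N ^ 2 + 4 * a * lamz ^ 2) by (apply pow2_sqrt; nra).
  assert (HQN : N <= Q).
  { apply Rsqr_incr_0_var; [rewrite !Rsqr_pow2; nra | apply sqrt_pos]. }
  set (M := (N + Q) / 2).
  assert (HNM : N <= M) by (unfold M; lra).
  assert (HM2 : M ^ 2 = N * M + a * lamz ^ 2) by (unfold M; nra).
  clearbody M. clear Q HQ2 HQN.
  set (S := sqrt M). assert (HS : 0 < S) by (apply sqrt_lt_R0; lra).
  assert (HS2 : S ^ 2 = M) by (apply pow2_sqrt; lra).
  pose proof (Rabs_pos_lt _ Hz) as Habs.
  assert (Habs2 : Rabs lamz ^ 2 = lamz ^ 2) by apply pow2_abs.
  assert (HzM : lamz ^ 2 < M).
  { apply Rnot_le_lt. intros HMz.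
    assert (M * (a + N) <= M ^ 2); nra. }
  set (s0 := Rabs lamz / S).
  assert (Hs0S : s0 * S = Rabs lamz) by (unfold s0; field; lra).
  assert (Hs0 : 0 < s0 < 1).
  { split; [apply Rdiv_lt_0_compat; lra|].
    apply (Rmult_lt_reg_r S); [lra|]. rewrite Hs0S. nra. }
  assert (Hs0M : s0 ^ 2 * M = lamz ^ 2) by (rewrite <- Habs2, <- Hs0S, <- HS2; ring).
  assert (HMN : M = N + a * s0 ^ 2) by (apply (Rmult_eq_reg_r M); nra).
  pose proof (polar_angle_bound s0 Hs0) as Hth0.
  assert (Hfac : forall th, sin th <> 0 ->
    lam ^ 2 - polar_k al eps lamz th
    = (sin th ^ 2 - s0 ^ 2) / sin th ^ 2 * (M + a * sin th ^ 2)).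
  { intros th Hth. unfold polar_k.
    replace (cos th ^ 2) with (1 - sin th ^ 2) by (rewrite sin_pow2; ring).
    replace ((sin th ^ 2 - s0 ^ 2) / sin th ^ 2 * (M + a * sin th ^ 2))
      with (M - a * s0 ^ 2 + a * sin th ^ 2 - s0 ^ 2 * M / sin th ^ 2) by (field; lra).
    rewrite Hs0M, HMN. unfold a, N. field. lra. }
  assert (Htp : polar_turning_points al lam eps lamz = (asin s0, PI - asin s0)).
  { apply polar_turning_points_eq; [lra | lra|].
    intros th Hth. rewrite <- (sin_eq_iff s0 th Hs0 Hth).
    assert (Hs : 0 < sin th) by (apply sin_gt_0; lra).
    specialize (Hfac th ltac:(lra)).
    assert (HMa : 0 < M + a * sin th ^ 2) by nra.
    assert (Heq : (lam ^ 2 - polar_k al eps lamz th) * sin th ^ 2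
             = (sin th - s0) * ((sin th + s0) * (M + a * sin th ^ 2)))
      by (rewrite Hfac; field; lra).
    split; intros H.
    - rewrite H, Rminus_diag, Rmult_0_l in Heq. symmetry in Heq.
      apply Rmult_integral in Heq as [Heq | Heq]; [lra|nra].
    - rewrite H, Rminus_diag, Rmult_0_l in Heq.
      apply Rmult_integral in Heq as [Heq | Heq]; [lra|nra]. }
  unfold polar_action. rewrite Htp. simpl fst. simpl snd.
  set (I := RInt _ _ _).
  assert (HI : is_RInt (fun th => sqrt (lam ^ 2 - polar_k al eps lamz th))
                 (asin s0) (PI - asin s0) I).
  { apply (RInt_correct (fun th => sqrt (lam ^ 2 - polar_k al eps lamz th))), ex_RInt_continuous.
    rewrite Rmin_left, Rmax_right by lra. intros th Hth.
    assert (0 < sin th) by (apply sin_gt_0; lra).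
    apply (continuous_sqrt_comp (fun th => lam ^ 2 - polar_k al eps lamz th)).
    apply (ex_derive_continuous (fun th => lam ^ 2 - polar_k al eps lamz th)).
    unfold polar_k. auto_derive. lra. }
  assert (Hint : forall th, asin s0 < th < PI - asin s0 ->
    sqrt (lam ^ 2 - polar_k al eps lamz th)
    = sqrt (sin th ^ 2 - s0 ^ 2) / sin th * sqrt (M + a * sin th ^ 2)).
  { intros th Hth.
    assert (Hs : 0 < sin th) by (apply sin_gt_0; lra).
    assert (Hs' : s0 ^ 2 <= sin th ^ 2).
    { pose proof (polar_cos_bound s0 Hs0 th ltac:(lra)). pose proof (polar_cos_sqr s0 Hs0).
      rewrite sin_pow2. nra. }
    rewrite Hfac by lra.
    rewrite sqrt_mult; [| apply Rdiv_le_0_compat; nra | nra].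
    rewrite sqrt_div, sqrt_pow2 by nra. reflexivity. }
  pose proof (is_RInt_polar s0 Hs0) as HW.
  pose proof PI_RGT_0 as HPI.
  assert (Hlow : S * (PI * (1 - s0)) <= I).
  { apply (is_RInt_le (fun th => S * (sqrt (sin th ^ 2 - s0 ^ 2) / sin th))
       (fun th => sqrt (lam ^ 2 - polar_k al eps lamz th)) (asin s0) (PI - asin s0)); [lra | | exact HI |].
    - apply (is_RInt_scal (fun th => sqrt (sin th ^ 2 - s0 ^ 2) / sin th)), HW.
    - intros th Hth. rewrite Hint, Rmult_comm by exact Hth.
      assert (Hs : 0 < sin th) by (apply sin_gt_0; lra).
      apply Rmult_le_compat_l.
      + apply Rdiv_le_0_compat; [apply sqrt_pos | lra].
      + apply sqrt_le_1_alt. nra. }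
  assert (Hup : I <= (S + a / (2 * S)) * (PI * (1 - s0))).
  { apply (is_RInt_le (fun th => sqrt (lam ^ 2 - polar_k al eps lamz th))
       (fun th => (S + a / (2 * S)) * (sqrt (sin th ^ 2 - s0 ^ 2) / sin th)) (asin s0) (PI - asin s0)); [lra | exact HI | |].
    - apply (is_RInt_scal (fun th => sqrt (sin th ^ 2 - s0 ^ 2) / sin th)), HW.
    - intros th Hth. rewrite Hint, (Rmult_comm (S + _)) by exact Hth.
      assert (Hs : 0 < sin th) by (apply sin_gt_0; lra).
      assert (HaS : 0 <= a / (2 * S)) by (apply Rdiv_le_0_compat; lra).
      apply Rmult_le_compat_l.
      + apply Rdiv_le_0_compat; [apply sqrt_pos | lra].
      + rewrite <- (sqrt_pow2 (S + a / (2 * S))) by lra. apply sqrt_le_1_alt.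
        replace ((S + a / (2 * S)) ^ 2) with (S ^ 2 + a + (a / (2 * S)) ^ 2) by (field; lra).
        assert (Hs1 : sin th ^ 2 <= 1) by (pose proof (SIN_bound th); nra).
        pose proof (Rmult_le_compat_l a _ _ Ha Hs1).
        pose proof (pow2_ge_0 (a / (2 * S))). lra. }
  set (T := sqrt N). assert (HT : 0 < T) by (apply sqrt_lt_R0; lra).
  assert (HT2 : T ^ 2 = N) by (apply pow2_sqrt; lra).
  assert (HTS : T <= S) by (apply sqrt_le_1_alt; lra).
  assert (HaT : 0 <= a / (2 * T)) by (apply Rdiv_le_0_compat; lra).
  assert (HST : S <= T + a / (2 * T)).
  { rewrite <- (sqrt_pow2 (T + a / (2 * T))) by lra. apply sqrt_le_1_alt.
    replace ((T + a / (2 * T)) ^ 2) with (T ^ 2 + a + (a / (2 * T)) ^ 2) by (field; lra).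
    nra. }
  assert (HaST : a / (2 * S) <= a / (2 * T)).
  { apply Rmult_le_compat_l; [lra|]. apply Rinv_le_contravar; lra. }
  assert (HaS : 0 <= a / (2 * S)) by (apply Rdiv_le_0_compat; lra).
  assert (HIpi : / PI * I * PI = I) by (field; lra).
  replace (a / T) with (a / (2 * T) + a / (2 * T)) by (field; lra).
  (* Since [s0 S = Rabs lamz], the part [- s0 S] of the integral cancels the added [Rabs lamz] and
     leaves [S], which lies between [T] and [T + a / (2 T)]. *)
  split.
  - assert (S * (1 - s0) <= / PI * I) by (apply (Rmult_le_reg_r PI); lra). nra.
  - assert (/ PI * I <= (S + a / (2 * S)) * (1 - s0)) by (apply (Rmult_le_reg_r PI); lra). nra.
Qed.

(** * Radial action and turning points *)

(** The square root is [x - s / 2 + O(1 / x)] and the reciprocal of the denominator is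
    [1 / x^2 + 2 / x^3 + O(1 / x^4)]; their product has [2 - s / 2] as coefficient of [1 / x^2]. *)
Lemma radial_kernel_approx (al s q x : R) :
  0 <= al <= 1 -> Rabs s <= 3 -> Rabs q <= 2 -> 10 <= x ->
  Rabs (sqrt (x ^ 2 - s * x + q) / (x ^ 2 - 2 * x + al ^ 2)
        - (/ x + (2 - s / 2) / x ^ 2)) <= 44 / x ^ 3.
Proof.
  intros Hal Hs Hq Hx.
  apply Rabs_le_between in Hs. apply Rabs_le_between in Hq.
  set (y := sqrt (x ^ 2 - s * x + q)).
  assert (Hy : 0 <= y) by apply sqrt_pos.
  assert (Hy2 : y ^ 2 = x ^ 2 - s * x + q) by (apply pow2_sqrt; nra).
  (* Rationalizing this difference gives a numerator of size at most [5] over a denominator of at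
     least [x / 2], hence the bound [10] for [d x]. *)
  set (d := y - (x - s / 2)).
  assert (Hdy : d * (y + x - s / 2) = q - s ^ 2 / 4) by (unfold d; nra).
  assert (Hdx : Rabs (d * x) <= 10).
  { assert (Hden : x / 2 <= y + x - s / 2) by lra.
    assert (Hr : Rabs (q - s ^ 2 / 4) <= 5) by (apply Rabs_le; nra).
    rewrite <- Hdy, Rabs_mult, (Rabs_pos_eq (y + x - s / 2)) in Hr by lra.
    rewrite Rabs_mult, (Rabs_pos_eq x) by lra. pose proof (Rabs_pos d). nra. }
  apply Rabs_le_between in Hdx.
  set (D := x ^ 2 - 2 * x + al ^ 2).
  assert (HD : x ^ 2 / 2 <= D) by (unfold D; nra).
  assert (HD0 : 0 < D) by nra.
  (* [n] is the numerator of the error over [x D]; [22] as a bound for it and [D >= x^2 / 2] produce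
     the [44]. *)
  set (n := d * x - (al ^ 2 - 2 * (2 - s / 2)) - (2 - s / 2) * al ^ 2 / x).
  assert (Hn : y / D - (/ x + (2 - s / 2) / x ^ 2) = n / (x * D)).
  { unfold n, d, D in *. field. lra. }
  assert (Hc : 0 <= (2 - s / 2) * al ^ 2 / x <= 1).
  { assert (0 <= (2 - s / 2) * al ^ 2 <= 4) by (assert (0 <= al ^ 2 <= 1) by nra; nra).
    split; [apply Rdiv_le_0_compat; lra|].
    apply (Rmult_le_reg_r x); [lra|]. unfold Rdiv. rewrite Rmult_assoc, Rinv_l; lra. }
  assert (Hn2 : Rabs n <= 22) by (apply Rabs_le; unfold n; nra).
  rewrite Hn. unfold Rdiv. rewrite Rabs_mult, Rabs_inv, (Rabs_pos_eq (x * D)) by nra.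
  replace (44 * / x ^ 3) with (22 * / (x * (x ^ 2 / 2))) by (field; lra).
  apply Rmult_le_compat; [apply Rabs_pos | left; apply Rinv_0_lt_compat; nra | exact Hn2 |].
  apply Rinv_le_contravar; nra.
Qed.

Lemma radial_action_approx (al be lam eps x1 x2 k s q g : R) :
  let c := (x1 + x2) / 2 in
  0 <= al <= 1 -> 10 <= x1 < x2 -> 0 <= k -> Rabs s <= 3 -> Rabs q <= 2 ->
  0 < g -> g ^ 2 = x1 * x2 ->
  (forall x, radial_R al be lam eps x = k * ((x2 - x) * (x - x1)) * (x ^ 2 - s * x + q)) ->
  Rabs (radial_action al be lam eps x1 x2
        - sqrt k * (c - g + (2 - s / 2) * (c / g - 1)))
  <= 44 * sqrt k * (c / g - 1) / x1.
Proof.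
  intros c Hal Hx12 Hk Hs Hq Hg Hg2 HR.
  pose proof (is_RInt_kepler1 x1 x2 g ltac:(lra) ltac:(lra) Hg Hg2) as H1.
  pose proof (is_RInt_kepler2 x1 x2 g ltac:(lra) ltac:(lra) Hg Hg2) as H2.
  fold c in H1, H2.
  unfold radial_action. set (I := RInt _ x1 x2).
  set (h x := sqrt (radial_R al be lam eps x) / (x ^ 2 - 2 * x + al ^ 2)).
  assert (HI : is_RInt h x1 x2 I).
  { apply (RInt_correct h), ex_RInt_continuous.
    rewrite Rmin_left, Rmax_right by lra. intros x Hx.
    apply (continuous_mult (fun x => sqrt (radial_R al be lam eps x))
             (fun x => / (x ^ 2 - 2 * x + al ^ 2))).
    - apply (continuous_sqrt_comp (radial_R al be lam eps)).
      apply (ex_derive_continuous (radial_R al be lam eps)).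
      unfold radial_R. auto_derive. trivial.
    - apply (ex_derive_continuous (fun x => / (x ^ 2 - 2 * x + al ^ 2))).
      auto_derive. nra. }
  (* On the interval [44 / x^3] is at most [(44 / x1) / x^2], so the error is absorbed into a shift
     [t] of the coefficient of [1 / x^2], and the two Kepler integrals suffice. *)
  set (W t x := sqrt k * (sqrt ((x2 - x) * (x - x1)) / x)
      + sqrt k * (2 - s / 2 + t) * (sqrt ((x2 - x) * (x - x1)) / x ^ 2)).
  assert (HW : forall t, is_RInt (W t) x1 x2
     (sqrt k * (PI * (c - g)) + sqrt k * (2 - s / 2 + t) * (PI * (c / g - 1)))).
  { intros t.
    apply (is_RInt_plus (fun x => sqrt k * (sqrt ((x2 - x) * (x - x1)) / x))
       (fun x => sqrt k * (2 - s / 2 + t) * (sqrt ((x2 - x) * (x - x1)) / x ^ 2))).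
    - apply (is_RInt_scal (fun x => sqrt ((x2 - x) * (x - x1)) / x)), H1.
    - apply (is_RInt_scal (fun x => sqrt ((x2 - x) * (x - x1)) / x ^ 2)), H2. }
  assert (Hh : forall x, x1 < x < x2 -> W (- (44 / x1)) x <= h x <= W (44 / x1) x).
  { intros x Hx.
    pose proof (radial_kernel_approx al s q x Hal Hs Hq ltac:(lra)) as Ha.
    apply Rabs_le_between in Hs. apply Rabs_le_between in Hq.
    apply Rabs_le_between in Ha.
    set (y := sqrt ((x2 - x) * (x - x1))).
    assert (Hy : 0 <= y) by apply sqrt_pos.
    pose proof (sqrt_pos k) as Hk'.
    assert (Hhx : h x = sqrt k * y * (sqrt (x ^ 2 - s * x + q) / (x ^ 2 - 2 * x + al ^ 2))).
    { unfold h. rewrite HR.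
      rewrite sqrt_mult, sqrt_mult; [fold y; unfold Rdiv; ring | lra | nra | | nra].
      apply Rmult_le_pos; nra. }
    assert (HWx : forall t, W t x = sqrt k * y * (/ x + (2 - s / 2) / x ^ 2 + t / x ^ 2)).
    { intros t. unfold W. fold y. field. lra. }
    assert (H44 : 44 / x ^ 3 <= 44 / x1 / x ^ 2).
    { replace (44 / x1 / x ^ 2) with (44 * / (x1 * x ^ 2)) by (field; lra).
      apply Rmult_le_compat_l; [lra|]. apply Rinv_le_contravar; nra. }
    rewrite Hhx, !HWx.
    assert (0 <= sqrt k * y) by nra.
    replace (- (44 / x1) / x ^ 2) with (- (44 / x1 / x ^ 2)) by (field; lra).
    split; apply Rmult_le_compat_l; lra. }
  pose proof PI_RGT_0 as HPI.
  pose proof (is_RInt_le _ _ x1 x2 _ _ ltac:(lra) (HW (- (44 / x1))) HI (fun x Hx => proj1 (Hh x Hx))) as Hlow.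
  pose proof (is_RInt_le _ _ x1 x2 _ _ ltac:(lra) HI (HW (44 / x1)) (fun x Hx => proj2 (Hh x Hx))) as Hup.
  assert (HIpi : / PI * I * PI = I) by (field; lra).
  set (z := c / g - 1) in *.
  assert (H44 : 44 * sqrt k * z / x1 = sqrt k * (44 / x1) * z) by (field; lra).
  rewrite H44.
  apply Rabs_le; split; apply (Rmult_le_reg_r PI); lra.
Qed.

(** * A priori bounds at the turning points *)

Lemma orbit_facts (al be p e lam eps : R) :
  orbit al be p e lam eps ->
  -1 < be < 1 /\ 0 < lam /\ eps < 1 /\ 0 < p /\ 0 < e < 1 /\
  horizon al < p / (1 + e) < p / (1 - e) /\
  w al be lam (p / (1 + e)) = eps /\ w al be lam (p / (1 - e)) = eps.
Proof.
  intros [[Hbe [[lms [[Hlms _] Hlam]] [a [b [_ Heps]]]]] [Hp [He [xm [xn [[_ [Hc _]] [Hx Hw]]]]]]].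
  (* [xm] is itself a critical point, hence outside the horizon; the turning points lie beyond
     it. *)
  assert (Hm : horizon al < xm) by (apply (Hc xm); now left).
  pose proof (Rmin_l 1 (w al be lam a)).
  repeat match goal with |- _ /\ _ => split end; try lra.
  - apply Hw; [lra | now left].
  - apply Hw; [lra | now right].
Qed.

Lemma horizon_quadratic_pos (al x : R) :
  0 <= al < 1 -> horizon al < x -> 1 < x /\ 0 < x ^ 2 - 2 * x + al ^ 2.
Proof.
  unfold horizon. intros Hal Hx.
  pose proof (sqrt_pos (1 - al ^ 2)).
  assert (sqrt (1 - al ^ 2) ^ 2 = 1 - al ^ 2) by (apply pow2_sqrt; nra).
  split; nra.
Qed.

(** The sign of [y], lost in squaring [w = eps], is recorded because the lower bound on [eps] comes
    from comparing squares. *)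
Lemma w_sqrt_sqr (al be lam eps x : R) :
  0 <= al < 1 -> horizon al < x -> w al be lam x = eps ->
  let y := eps * x ^ 2 - al * be * lam in
  0 <= y /\ y ^ 2 = (x ^ 2 - 2 * x + al ^ 2) * (x ^ 2 + lam ^ 2).
Proof.
  intros Hal Hx Hw y. destruct (horizon_quadratic_pos al x Hal Hx) as [Hx1 HD].
  unfold w in Hw.
  replace ((1 - 2 / x + al ^ 2 / x ^ 2) * (1 + lam ^ 2 / x ^ 2))
    with ((x ^ 2 - 2 * x + al ^ 2) * (x ^ 2 + lam ^ 2) / (x ^ 2) ^ 2) in Hw by (field; lra).
  set (Z := (x ^ 2 - 2 * x + al ^ 2) * (x ^ 2 + lam ^ 2)) in *.
  assert (HZ : 0 <= Z) by (apply Rmult_le_pos; nra).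
  rewrite sqrt_div_alt in Hw by (apply pow_lt; nra).
  rewrite sqrt_pow2 in Hw by nra.
  assert (Hy : y = sqrt Z) by (unfold y; rewrite <- Hw; field; lra).
  rewrite Hy. split; [apply sqrt_pos | apply pow2_sqrt, HZ].
Qed.

Lemma w_level_root (al be lam eps x : R) :
  0 <= al < 1 -> horizon al < x -> w al be lam x = eps -> radial_R al be lam eps x = 0.
Proof.
  intros Hal Hx Hw. destruct (w_sqrt_sqr al be lam eps x Hal Hx Hw) as [_ H].
  unfold radial_R. rewrite H. ring.
Qed.

(** From [eps < 1] one has [y <= x^2 + lam], and comparing squares limits [lam^2] to order [x]. Then
    [lam <= x] and [y >= x^2 - 2 x], so [eps x^2 >= x^2 - 2 x - lam], whence the [3]. *)
Lemma w_level_bounds (al be lam eps x : R) :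
  0 <= al < 1 -> -1 < be < 1 -> 0 < lam -> 10 <= x ->
  w al be lam x = eps -> eps < 1 -> lam ^ 2 <= 6 * x /\ 1 - 3 / x <= eps.
Proof.
  intros Hal Hbe Hlam Hx Hw Heps.
  assert (Hhor : horizon al < x).
  { unfold horizon. pose proof (sqrt_le_1_alt (1 - al ^ 2) 1 ltac:(nra)).
    rewrite sqrt_1 in H. lra. }
  destruct (w_sqrt_sqr al be lam eps x Hal Hhor Hw) as [Hy Hy2].
  set (y := eps * x ^ 2 - al * be * lam) in *.
  assert (Hab : - 1 <= al * be <= 1) by nra.
  assert (Habl : - lam <= al * be * lam <= lam) by nra.
  assert (Hyu : y <= x ^ 2 + lam) by (unfold y; nra).
  assert (Hyu2 : y ^ 2 <= (x ^ 2 + lam) ^ 2) by nra.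
  assert (Hal2 : 0 <= al ^ 2 <= 1) by nra.
  assert (Hl : lam ^ 2 <= 6 * x).
  { rewrite Hy2 in Hyu2.
    assert (H1 : (x ^ 2 - 2 * x) * (x ^ 2 + lam ^ 2) <= (x ^ 2 + lam) ^ 2) by nra.
    assert (H2 : x ^ 2 * (lam ^ 2 * (x ^ 2 - 2 * x - 1)) <= x ^ 2 * (2 * x ^ 3 + 2 * x ^ 2 * lam)) by nra.
    assert (H3 : lam ^ 2 * (x ^ 2 - 2 * x - 1) <= x ^ 2 * (2 * x + 2 * lam)).
    { apply (Rmult_le_reg_l (x ^ 2)); nra. }
    (* [79 / 100] is [1 - 2 / 10 - 1 / 100], the worst case [x = 10]. *)
    assert (H4 : 79 / 100 * x ^ 2 <= x ^ 2 - 2 * x - 1) by nra.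
    assert (H5 : 79 / 100 * lam ^ 2 <= 2 * x + 2 * lam).
    { apply (Rmult_le_reg_l (x ^ 2)); nra. }
    nra. }
  split; [exact Hl|].
  assert (Hlx : lam <= x) by nra.
  assert (Hyl : x ^ 2 - 2 * x <= y).
  { apply Rsqr_incr_0_var; [|exact Hy]. rewrite !Rsqr_pow2, Hy2.
    assert (0 <= x ^ 2 - 2 * x) by nra.
    assert ((x ^ 2 - 2 * x) * (x ^ 2 - 2 * x) <= (x ^ 2 - 2 * x + al ^ 2) * (x ^ 2 + lam ^ 2)); [|nra].
    apply Rmult_le_compat; nra. }
  apply (Rmult_le_reg_r (x ^ 2)); [nra|].
  replace ((1 - 3 / x) * x ^ 2) with (x ^ 2 - 3 * x) by (field; lra).
  unfold y in Hyl. lra.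
Qed.

(** * The quartic and its factorization *)

Definition radial_B (al be lam eps : R) : R := lam ^ 2 + al ^ 2 + 2 * al * be * eps * lam.

Lemma radial_R_expand (al be lam eps x : R) :
  radial_R al be lam eps x
  = - (1 - eps ^ 2) * x ^ 4 + 2 * x ^ 3 - radial_B al be lam eps * x ^ 2
    + 2 * lam ^ 2 * x - al ^ 2 * (1 - be ^ 2) * lam ^ 2.
Proof. unfold radial_R, radial_B. ring. Qed.

(* Vieta's relations for two roots, solved for [B] and [1 - eps ^ 2]. *)
Lemma radial_root_relations (al be lam eps m e : R) :
  0 < m -> 0 < e < 1 ->
  radial_R al be lam eps (/ m ^ 2 / (1 + e)) = 0 ->
  radial_R al be lam eps (/ m ^ 2 / (1 - e)) = 0 ->
  let B := radial_B al be lam eps in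
  let A := al ^ 2 * (1 - be ^ 2) * lam ^ 2 in
  B * m ^ 2 = 1 + lam ^ 2 * m ^ 4 * (3 + e ^ 2) - 2 * A * m ^ 6 * (1 + e ^ 2) /\
  1 - eps ^ 2 = m ^ 4 * (1 - e ^ 2) * (B - 4 * lam ^ 2 * m ^ 2 + A * m ^ 4 * (3 + e ^ 2)).
Proof.
  intros Hm He H1 H2 B A. rewrite radial_R_expand in H1, H2. fold B A in H1, H2.
  set (k := 1 - eps ^ 2) in *. clearbody k B A.
  (* [P (1 / x)] is the quartic divided by [x^4]; in this variable the roots [(1 + e) m^2] and
     [(1 - e) m^2] are polynomial. *)
  set (P u := - k + 2 * u - B * u ^ 2 + 2 * lam ^ 2 * u ^ 3 - A * u ^ 4).
  assert (Hm2 : 0 < m ^ 2) by nra.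
  assert (P1 : P ((1 + e) * m ^ 2) = 0).
  { rewrite <- (Rmult_0_l (((1 + e) * m ^ 2) ^ 4)), <- H1. unfold P. field. lra. }
  assert (P2 : P ((1 - e) * m ^ 2) = 0).
  { rewrite <- (Rmult_0_l (((1 - e) * m ^ 2) ^ 4)), <- H2. unfold P. field. lra. }
  unfold P in P1, P2. clear H1 H2 P.
  assert (H : B * m ^ 2 = 1 + lam ^ 2 * m ^ 4 * (3 + e ^ 2) - 2 * A * m ^ 6 * (1 + e ^ 2)).
  (* Subtracting the two root equations leaves the common factor [4 e m^2]. *)
  { apply (Rmult_eq_reg_l (4 * e * m ^ 2)); nra. }
  split; [exact H|]. nra.
Qed.

(** [q] and [s] are read off the coefficients of [x^0] and [x^1]; those of [x^3] and [x^2] then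
    match by the two Vieta relations. The latter two identities are kept: they supply the leading
    term of [j3] and the expansion of [B]. *)
Lemma radial_R_factor (al be lam eps m e : R) :
  let k := 1 - eps ^ 2 in
  let B := radial_B al be lam eps in
  let A := al ^ 2 * (1 - be ^ 2) * lam ^ 2 in
  let q := A * (1 - e ^ 2) * m ^ 4 / k in
  let s := 2 * lam ^ 2 * (1 - e ^ 2) * m ^ 4 / k - 2 * q * m ^ 2 in
  0 < m -> 0 < e < 1 -> 0 < k ->
  B * m ^ 2 = 1 + lam ^ 2 * m ^ 4 * (3 + e ^ 2) - 2 * A * m ^ 6 * (1 + e ^ 2) ->
  k = m ^ 4 * (1 - e ^ 2) * (B - 4 * lam ^ 2 * m ^ 2 + A * m ^ 4 * (3 + e ^ 2)) ->
  (forall x, radial_R al be lam eps x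
     = k * ((/ m ^ 2 / (1 - e) - x) * (x - / m ^ 2 / (1 + e))) * (x ^ 2 - s * x + q)) /\
  k * (s + 2 / (m ^ 2 * (1 - e ^ 2))) = 2 /\
  B = k * (1 / (m ^ 4 * (1 - e ^ 2)) + 2 * s / (m ^ 2 * (1 - e ^ 2)) + q).
Proof.
  intros k B A q s Hm He Hk HB HkB.
  assert (Hs : k * s = 2 * lam ^ 2 * (1 - e ^ 2) * m ^ 4 - 2 * A * (1 - e ^ 2) * m ^ 6)
    by (unfold s, q; field; lra).
  assert (Hq : k * q = A * (1 - e ^ 2) * m ^ 4) by (unfold q; field; lra).
  assert (HE : 0 < 1 - e ^ 2) by nra.
  assert (Hm2 : 0 < m ^ 2) by nra. assert (Hm4 : 0 < m ^ 4) by nra.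
  assert (Hk2 : k / (m ^ 2 * (1 - e ^ 2)) = B * m ^ 2 - 4 * lam ^ 2 * m ^ 4 + A * m ^ 6 * (3 + e ^ 2))
    by (rewrite HkB; field; lra).
  assert (E1 : k * (s + 2 / (m ^ 2 * (1 - e ^ 2))) = 2).
  { replace (k * (s + 2 / (m ^ 2 * (1 - e ^ 2)))) with (k * s + 2 * (k / (m ^ 2 * (1 - e ^ 2)))) by (field; lra).
    rewrite Hs, Hk2, HB. ring. }
  assert (E2 : B = k * (1 / (m ^ 4 * (1 - e ^ 2)) + 2 * s / (m ^ 2 * (1 - e ^ 2)) + q)).
  { replace (k * (1 / (m ^ 4 * (1 - e ^ 2)) + 2 * s / (m ^ 2 * (1 - e ^ 2)) + q))
      with (k / (m ^ 4 * (1 - e ^ 2)) + 2 * (k * s) / (m ^ 2 * (1 - e ^ 2)) + k * q) by (field; lra).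
    rewrite Hs, Hq. rewrite HkB at 1. field. lra. }
  split; [|split; assumption].
  intros x. rewrite radial_R_expand. fold B A k.
  rewrite <- E1 at 1. rewrite E2.
  replace (2 * lam ^ 2 * x) with ((k * s + 2 * (k * q) * m ^ 2) / ((1 - e ^ 2) * m ^ 4) * x)
    by (rewrite Hs, Hq; field; lra).
  replace A with (k * q / ((1 - e ^ 2) * m ^ 4)) by (rewrite Hq; field; lra).
  clearbody s q. field. repeat split; lra.
Qed.

(** * Uniform asymptotic expansions *)

(** [C] is fixed before the point [t], so the bound is uniform in every parameter that [t] carries
    besides [mu]. *)
Definition bigO {T : Type} (F : (T -> Prop) -> Prop) (mu : T -> R) (n : nat) (f : T -> R) : Prop :=
  exists C, F (fun t => Rabs (f t) <= C * mu t ^ n).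

Definition to_zero {T : Type} (F : (T -> Prop) -> Prop) (mu : T -> R) : Prop :=
  forall d, 0 < d -> F (fun t => 0 < mu t < d).

Lemma filter_app {T : Type} (F : (T -> Prop) -> Prop) {FF : Filter F} (P Q : T -> Prop) :
  F P -> F (fun t => P t -> Q t) -> F Q.
Proof.
  intros HP HQ. apply (filter_imp (fun t => P t /\ (P t -> Q t))); [tauto|].
  now apply filter_and.
Qed.

Ltac absorb_filter_hyps :=
  lazymatch goal with
  | |- ?F _ -> _ =>
      let H := fresh in
      intro H; absorb_filter_hyps; apply (filter_app F _ _ H); clear H
  | _ => idtac
  end.

(* Reduces [F Q] to the pointwise statement that the listed hypotheses [F P] imply [Q]. *)
Tactic Notation "eventually" ne_hyp_list(Hs) :=
  revert Hs; absorb_filter_hyps; apply filter_forall.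

Section BigO.

Context {T : Type} (F : (T -> Prop) -> Prop) {FF : Filter F} (mu : T -> R)
  (Hmu : to_zero F mu).

Lemma bigO_ext n (f g : T -> R) :
  F (fun t => f t = g t) -> bigO F mu n f -> bigO F mu n g.
Proof.
  intros H [C HC]. exists C. eventually H HC. intros t Heq Hf. now rewrite <- Heq.
Qed.

Lemma bigO_weaken a n (f : T -> R) : bigO F mu a f -> (n <= a)%nat -> bigO F mu n f.
Proof.
  (* [C] carries no sign condition, so its absolute value is taken before a power of [mu] is
     dropped. *)
  intros [C HC] Hn. exists (Rabs C). pose proof (Hmu 1 Rlt_0_1) as H1. eventually HC H1.
  intros t Hf Ht. eapply Rle_trans; [apply Hf|].
  replace a with (n + (a - n))%nat by lia. rewrite pow_add.
  assert (H2 : 0 <= mu t ^ n) by (apply pow_le; lra).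
  assert (H3 : 0 <= mu t ^ (a - n) <= 1).
  { split; [apply pow_le; lra|]. rewrite <- (pow1 (a - n)). apply pow_incr. lra. }
  pose proof (Rle_abs C). pose proof (Rabs_pos C).
  assert (C * (mu t ^ n * mu t ^ (a - n)) <= Rabs C * (mu t ^ n * mu t ^ (a - n)))
    by (apply Rmult_le_compat_r; nra).
  assert (Rabs C * (mu t ^ n * mu t ^ (a - n)) <= Rabs C * (mu t ^ n * 1))
    by (apply Rmult_le_compat_l; nra).
  lra.
Qed.

Lemma bigO_plus a b (f g : T -> R) :
  bigO F mu a f -> bigO F mu b g -> bigO F mu (Nat.min a b) (fun t => f t + g t).
Proof.
  intros Hf Hg.
  apply (bigO_weaken _ (Nat.min a b)) in Hf; [|lia].
  apply (bigO_weaken _ (Nat.min a b)) in Hg; [|lia].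
  destruct Hf as [Cf Hf], Hg as [Cg Hg]. exists (Cf + Cg). eventually Hf Hg.
  intros t H1 H2. pose proof (Rabs_triang (f t) (g t)). lra.
Qed.

Lemma bigO_opp a (f : T -> R) : bigO F mu a f -> bigO F mu a (fun t => - f t).
Proof.
  intros [C H]. exists C. eventually H. intros t Ht. now rewrite Rabs_Ropp.
Qed.

Lemma bigO_minus a b (f g : T -> R) :
  bigO F mu a f -> bigO F mu b g -> bigO F mu (Nat.min a b) (fun t => f t - g t).
Proof. intros Hf Hg. apply bigO_plus; [exact Hf | now apply bigO_opp]. Qed.

Lemma bigO_mult a b (f g : T -> R) :
  bigO F mu a f -> bigO F mu b g -> bigO F mu (a + b) (fun t => f t * g t).
Proof.
  intros [Cf Hf] [Cg Hg]. exists (Cf * Cg). eventually Hf Hg.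
  intros t H1 H2. rewrite Rabs_mult, pow_add.
  replace (Cf * Cg * (mu t ^ a * mu t ^ b)) with (Cf * mu t ^ a * (Cg * mu t ^ b)) by ring.
  apply Rmult_le_compat; auto using Rabs_pos.
Qed.

Lemma bigO_pow a n (f : T -> R) : bigO F mu a f -> bigO F mu (n * a) (fun t => f t ^ n).
Proof.
  intros Hf. induction n as [|n IH]; simpl.
  - exists 1. apply filter_forall. intros t. rewrite Rabs_R1. lra.
  - now apply bigO_mult.
Qed.

Lemma bigO_mu : bigO F mu 1 mu.
Proof.
  exists 1. pose proof (Hmu 1 Rlt_0_1) as H1. eventually H1.
  intros t Ht. rewrite Rabs_pos_eq; lra.
Qed.

Lemma bigO_const (c : R) : bigO F mu 0 (fun _ => c).
Proof. exists (Rabs c). apply filter_forall. intros t. lra. Qed.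

Lemma bigO_bounded (f : T -> R) (C : R) : F (fun t => Rabs (f t) <= C) -> bigO F mu 0 f.
Proof. intros H. exists C. eventually H. intros t Ht. lra. Qed.

Lemma bigO_inv (f : T -> R) (c : R) :
  0 < c -> F (fun t => c <= f t) -> bigO F mu 0 (fun t => / f t).
Proof.
  intros Hc H. apply (bigO_bounded _ (/ c)). eventually H. intros t Ht.
  rewrite Rabs_pos_eq; [apply Rinv_le_contravar; lra|].
  left. apply Rinv_0_lt_compat. lra.
Qed.

Lemma bigO_small n (f : T -> R) (d : R) :
  bigO F mu (S n) f -> 0 < d -> F (fun t => - d < f t < d).
Proof.
  intros Hf Hd. apply (bigO_weaken _ 1) in Hf; [|lia]. destruct Hf as [C HC].
  assert (H0 : 0 < d / (Rabs C + 1)) by (apply Rdiv_lt_0_compat; [lra | pose proof (Rabs_pos C); lra]).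
  pose proof (Hmu _ H0) as H1. eventually HC H1. intros t Hf Ht.
  apply Rabs_lt_between. eapply Rle_lt_trans; [exact Hf|]. rewrite pow_1.
  pose proof (Rle_abs C). pose proof (Rabs_pos C).
  assert (Hd' : d / (Rabs C + 1) * (Rabs C + 1) = d) by (field; lra).
  nra.
Qed.

(* [f ^ 2 - g ^ 2 = (f - g) (f + g)], with [f + g] bounded away from zero. *)
Lemma bigO_sqr_cancel n (f g : T -> R) (c : R) :
  0 < c -> F (fun t => c <= f t) -> F (fun t => 0 <= g t) ->
  bigO F mu n (fun t => f t ^ 2 - g t ^ 2) -> bigO F mu n (fun t => f t - g t).
Proof.
  intros Hc Hf Hg H.
  apply (bigO_ext n (fun t => (f t ^ 2 - g t ^ 2) * / (f t + g t))).
  - eventually Hf Hg. intros t H1 H2. field. lra.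
  - replace n with (n + 0)%nat by lia.
    apply (bigO_mult n 0 (fun t => f t ^ 2 - g t ^ 2)); [exact H|].
    apply (bigO_inv (fun t => f t + g t) c Hc). eventually Hf Hg. intros t H1 H2. lra.
Qed.

End BigO.

(** Hypotheses come before the structural rules: a recorded difference such as [L t - 1] must be
    recognized as a whole, since the rule for differences would only give order 0. This dictates how
    the expressions passed to [bigO_ext] are grouped. *)
Ltac bigO_infer F mu H :=
  first
  [ eassumption
  | lazymatch goal with
    | |- bigO _ _ _ (fun t => - _) => eapply (bigO_opp F mu); bigO_infer F mu H
    | |- bigO _ _ _ (fun t => _ + _) =>
        eapply (bigO_plus F mu H); [bigO_infer F mu H | bigO_infer F mu H]
    | |- bigO _ _ _ (fun t => _ - _) =>
        eapply (bigO_minus F mu H); [bigO_infer F mu H | bigO_infer F mu H]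
    | |- bigO _ _ _ (fun t => _ * _) =>
        eapply (bigO_mult F mu); [bigO_infer F mu H | bigO_infer F mu H]
    | |- bigO _ _ _ (fun t => _ / _) =>
        eapply (bigO_mult F mu); [bigO_infer F mu H | bigO_infer F mu H]
    | |- bigO _ _ _ (fun t => _ ^ _) => eapply (bigO_pow F mu); bigO_infer F mu H
    | |- _ => first [ apply (bigO_const F mu) | apply (bigO_mu F mu H) ]
    end ].

(* Bounds the order of an expression from below, treating the hypotheses as known orders. *)
Ltac bigO_tac :=
  lazymatch goal with
  | H : to_zero ?F ?mu |- bigO ?F ?mu _ _ =>
      eapply (bigO_weaken F mu H); [bigO_infer F mu H | simpl; lia]
  end.

(* Everything is rescaled to order one: L = lam mu, K = (1 - eps^2) / mu^2,
   b = B mu^2, and below Y2 = j2 mu, Y3 = j3 mu. *)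
Lemma momentum_expansion {T : Type} (F : (T -> Prop) -> Prop) {FF : Filter F}
  (mu be e eps L b K : T -> R) (al : R) :
  to_zero F mu -> 0 <= al < 1 ->
  F (fun t => -1 < be t < 1) -> F (fun t => 0 < e t < 1) ->
  F (fun t => 0 < L t /\ L t ^ 2 <= 6) ->
  F (fun t => 1 - 6 * mu t ^ 2 <= eps t < 1) ->
  F (fun t => b t = L t ^ 2 + al ^ 2 * mu t ^ 2 + 2 * al * be t * eps t * L t * mu t) ->
  F (fun t => b t = 1 + L t ^ 2 * mu t ^ 2 * (3 + e t ^ 2)
                    - 2 * (al ^ 2 * (1 - be t ^ 2) * L t ^ 2) * mu t ^ 4 * (1 + e t ^ 2)) ->
  F (fun t => K t = (1 - e t ^ 2) * (b t - 4 * L t ^ 2 * mu t ^ 2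
                    + al ^ 2 * (1 - be t ^ 2) * L t ^ 2 * mu t ^ 4 * (3 + e t ^ 2))) ->
  bigO F mu 0 L /\ bigO F mu 2 (fun t => 1 - eps t) /\
  bigO F mu 1 (fun t => L t - 1) /\
  bigO F mu 2 (fun t => L t ^ 2 - (1 - 2 * al * be t * mu t)) /\
  bigO F mu 2 (fun t => b t - 1) /\
  bigO F mu 2 (fun t => K t - (1 - e t ^ 2)).
Proof.
  intros Hmu Hal Hbe He HL Heps Hb1 Hb2 HK.
  assert (Obe : bigO F mu 0 be).
  { apply (bigO_bounded F mu be 1). eventually Hbe He HL Heps Hb1 Hb2 HK. intros. apply Rabs_le. lra. }
  assert (Oe : bigO F mu 0 e).
  { apply (bigO_bounded F mu e 1). eventually Hbe He HL Heps Hb1 Hb2 HK. intros. apply Rabs_le. lra. }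
  assert (OL : bigO F mu 0 L).
  { apply (bigO_bounded F mu L 3). eventually Hbe He HL Heps Hb1 Hb2 HK. intros. apply Rabs_le. nra. }
  assert (Oeps : bigO F mu 2 (fun t => 1 - eps t)).
  { exists 6. eventually Hbe He HL Heps Hb1 Hb2 HK. intros. rewrite Rabs_pos_eq; lra. }
  assert (Oeps0 : bigO F mu 0 eps).
  { apply (bigO_ext F mu 0 (fun t => 1 - (1 - eps t))).
    - apply filter_forall. intros t. ring.
    - bigO_tac. }
  assert (Ob : bigO F mu 2 (fun t => b t - 1)).
  { apply (bigO_ext F mu 2 (fun t => L t ^ 2 * mu t ^ 2 * (3 + e t ^ 2)
                    - 2 * (al ^ 2 * (1 - be t ^ 2) * L t ^ 2) * mu t ^ 4 * (1 + e t ^ 2))).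
    - eventually Hbe He HL Heps Hb2 HK. intros. lra.
    - bigO_tac. }
  assert (OL1' : bigO F mu 1 (fun t => L t ^ 2 - 1 ^ 2)).
  { apply (bigO_ext F mu 1 (fun t => (b t - 1) - al ^ 2 * mu t ^ 2 - 2 * al * be t * eps t * L t * mu t)).
    - eventually Hbe He HL Heps Hb1 HK. intros. lra.
    - bigO_tac. }
  assert (OL1 : bigO F mu 1 (fun t => L t - 1)).
  { apply (bigO_ext F mu 1 (fun t => (L t ^ 2 - 1 ^ 2) * / (L t + 1))).
    - eventually Hbe He HL Heps Hb1 Hb2 HK. intros. field. lra.
    - assert (bigO F mu 0 (fun t => / (L t + 1))).
      { apply (bigO_inv F mu (fun t => L t + 1) 1 Rlt_0_1). eventually Hbe He HL Heps Hb1 Hb2 HK. intros. lra. }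
      bigO_tac. }
  repeat split; try assumption.
  (* In the term linear in [mu], [eps L] is [1] up to [(L - 1) - (1 - eps) L], which is of order 1
     by the previous round. *)
  - apply (bigO_ext F mu 2 (fun t => (b t - 1) - al ^ 2 * mu t ^ 2
      - 2 * al * be t * mu t * ((L t - 1) - (1 - eps t) * L t))).
    + eventually Hbe He HL Heps Hb1 HK. intros. lra.
    + bigO_tac.
  - apply (bigO_ext F mu 2 (fun t => (1 - e t ^ 2) * ((b t - 1) - 4 * L t ^ 2 * mu t ^ 2
                    + al ^ 2 * (1 - be t ^ 2) * L t ^ 2 * mu t ^ 4 * (3 + e t ^ 2)))).
    + eventually Hbe He HL Heps HK. intros. lra.
    + bigO_tac.
Qed.

(** [q] is close to [al^2 (1 - be^2)], at most [1], and [s] is close to [2]; hence the bounds [2]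
    and [3] that the radial kernel estimate asks for. *)
Lemma quadratic_factor_expansion {T : Type} (F : (T -> Prop) -> Prop) {FF : Filter F}
  (mu be e L K q s : T -> R) (al e1 : R) :
  to_zero F mu -> 0 <= al < 1 -> 0 < e1 < 1 ->
  F (fun t => -1 < be t < 1) -> F (fun t => 0 < e t < e1) ->
  bigO F mu 0 L ->
  bigO F mu 2 (fun t => L t ^ 2 - (1 - 2 * al * be t * mu t)) ->
  bigO F mu 2 (fun t => K t - (1 - e t ^ 2)) ->
  F (fun t => q t = al ^ 2 * (1 - be t ^ 2) * L t ^ 2 * (1 - e t ^ 2) / K t) ->
  F (fun t => s t = 2 * L t ^ 2 * (1 - e t ^ 2) / K t - 2 * q t * mu t ^ 2) ->
  F (fun t => (1 - e1 ^ 2) / 2 <= K t) /\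
  bigO F mu 0 q /\ F (fun t => Rabs (q t) <= 2) /\
  bigO F mu 2 (fun t => s t - (2 - 4 * al * be t * mu t)) /\ F (fun t => Rabs (s t) <= 3).
Proof.
  intros Hmu Hal He1 Hbe He OL OL2 OK Hq Hs.
  assert (Obe : bigO F mu 0 be).
  { apply (bigO_bounded F mu be 1). eventually Hbe He Hq Hs. intros. apply Rabs_le. lra. }
  assert (Oe : bigO F mu 0 e).
  { apply (bigO_bounded F mu e 1). eventually Hbe He Hq Hs. intros. apply Rabs_le. lra. }
  assert (HE1 : 0 < (1 - e1 ^ 2) / 2) by nra.
  assert (HK : F (fun t => (1 - e1 ^ 2) / 2 <= K t)).
  { pose proof (bigO_small F mu Hmu _ _ _ OK HE1) as H. eventually He H. intros. nra. }
  assert (OiK : bigO F mu 0 (fun t => / K t)) by exact (bigO_inv F mu K _ HE1 HK).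
  assert (Oq1 : bigO F mu 1 (fun t => q t - al ^ 2 * (1 - be t ^ 2))).
  { apply (bigO_ext F mu 1 (fun t => al ^ 2 * (1 - be t ^ 2) *
      ((L t ^ 2 - (1 - 2 * al * be t * mu t) - 2 * al * be t * mu t) * (1 - e t ^ 2)
         - (K t - (1 - e t ^ 2))) * / K t)).
    - eventually Hq HK. intros t H1 H2. rewrite H1. field. lra.
    - bigO_tac. }
  assert (Oq : bigO F mu 0 q).
  { apply (bigO_ext F mu 0 (fun t => (q t - al ^ 2 * (1 - be t ^ 2)) + al ^ 2 * (1 - be t ^ 2))).
    - apply filter_forall. intros. ring.
    - bigO_tac. }
  assert (Os : bigO F mu 2 (fun t => s t - (2 - 4 * al * be t * mu t))).
  { apply (bigO_ext F mu 2 (fun t =>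
      2 * (L t ^ 2 - (1 - 2 * al * be t * mu t)) * (1 - e t ^ 2) * / K t
      - 2 * (1 - 2 * al * be t * mu t) * (K t - (1 - e t ^ 2)) * / K t
      - 2 * q t * mu t ^ 2)).
    - eventually Hs HK. intros t H1 H2. rewrite H1. field. lra.
    - bigO_tac. }
  assert (Os1 : bigO F mu 1 (fun t => s t - 2)).
  { apply (bigO_ext F mu 1 (fun t => (s t - (2 - 4 * al * be t * mu t)) - 4 * al * be t * mu t)).
    - apply filter_forall. intros. ring.
    - bigO_tac. }
  repeat split; try assumption.
  - pose proof (bigO_small F mu Hmu _ _ _ Oq1 Rlt_0_1) as H. eventually Hbe H. intros t Hb H. apply Rabs_le.
    assert (0 <= al ^ 2 <= 1) by nra. assert (0 <= be t ^ 2 <= 1) by nra. nra.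
  - pose proof (bigO_small F mu Hmu _ _ _ Os1 Rlt_0_1) as H. eventually H. intros t H. apply Rabs_le. lra.
Qed.

(** To leading order [Y2] is [kap / sE], which occurs with the opposite sign in the radial action:
    this degeneracy of Kepler motion leaves [K / sE^2], that is [1], as leading term of [kap Y3]. On
    its own [Y2] enters the energy only in terms with at least [mu^4], so order 2 is enough for
    it. *)
Lemma action_expansion {T : Type} (F : (T -> Prop) -> Prop) {FF : Filter F}
  (mu e b K kap sE q s nu Y2 Y3 : T -> R) (al e1 : R) :
  to_zero F mu -> 0 < e1 < 1 ->
  F (fun t => 0 < e t < e1) ->
  bigO F mu 2 (fun t => b t - 1) ->
  bigO F mu 2 (fun t => K t - (1 - e t ^ 2)) ->
  F (fun t => (1 - e1 ^ 2) / 2 <= K t) ->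
  bigO F mu 0 q -> F (fun t => Rabs (s t) <= 3) ->
  F (fun t => 0 < kap t /\ kap t ^ 2 = K t) ->
  F (fun t => 0 < sE t /\ sE t ^ 2 = 1 - e t ^ 2) ->
  F (fun t => K t * (s t * mu t ^ 2 + 2 / sE t ^ 2) = 2) ->
  F (fun t => b t = K t * (1 / sE t ^ 2 + 2 * s t * mu t ^ 2 / sE t ^ 2 + q t * mu t ^ 4)) ->
  F (fun t => 0 <= nu t /\ nu t ^ 2 = b t - 2 * al ^ 2 * K t * mu t ^ 4) ->
  F (fun t => nu t <= Y2 t <= nu t + al ^ 2 * K t * mu t ^ 4 / nu t) ->
  F (fun t => Rabs (Y3 t - Y2 t - kap t * (1 / sE t ^ 2 - 1 / sE t
                     + mu t ^ 2 * ((2 - s t / 2) * (1 / sE t - 1))))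
              <= 88 * kap t / sE t * mu t ^ 4) ->
  bigO F mu 2 (fun t => Y2 t * sE t / kap t - 1) /\
  bigO F mu 4 (fun t => kap t * Y3 t - (1 + K t * mu t ^ 2 * ((2 + s t / 2) / sE t - 2))).
Proof.
  intros Hmu He1 He Ob OK HK Oq Hs Hkap HsE HKs Hb Hnu HY2 HY3.
  assert (Oe : bigO F mu 0 e).
  { apply (bigO_bounded F mu e 1). eventually He HK Hs Hkap HsE Hnu. intros. apply Rabs_le. lra. }
  assert (Os : bigO F mu 0 s) by exact (bigO_bounded F mu s 3 Hs).
  assert (HE1 : 0 < (1 - e1 ^ 2) / 2) by nra.
  assert (HE1' : (1 - e1 ^ 2) / 2 < 1) by nra.
  assert (OK0 : bigO F mu 0 K).
  { apply (bigO_ext F mu 0 (fun t => (K t - (1 - e t ^ 2)) + (1 - e t ^ 2))).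
    - apply filter_forall. intros. ring.
    - bigO_tac. }
  set (c := (1 - e1 ^ 2) / 2) in *.
  assert (Hkapc : F (fun t => c <= kap t)).
  { eventually HK Hkap. intros t H1 [H2 H3]. nra. }
  assert (HsEc : F (fun t => c <= sE t)).
  { eventually He HsE. intros t H1 [H2 H3]. unfold c in *. nra. }
  assert (OiK : bigO F mu 0 (fun t => / K t)) by exact (bigO_inv F mu K _ HE1 HK).
  assert (Oikap : bigO F mu 0 (fun t => / kap t)) by exact (bigO_inv F mu kap _ HE1 Hkapc).
  assert (OisE : bigO F mu 0 (fun t => / sE t)) by exact (bigO_inv F mu sE _ HE1 HsEc).
  assert (OsE : bigO F mu 0 sE).
  { apply (bigO_bounded F mu sE 1). eventually He HsE. intros t H1 H2. apply Rabs_le. nra. }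
  assert (Okap : bigO F mu 0 kap).
  { apply (bigO_ext F mu 0 (fun t => K t * / kap t)).
    - eventually Hkap HsE. intros t [H1 H2] _.
      rewrite <- H2. field. lra.
    - bigO_tac. }
  assert (Hnu2 : F (fun t => / 2 <= nu t)).
  { assert (bigO F mu 2 (fun t => (b t - 1) - 2 * al ^ 2 * K t * mu t ^ 4)) by bigO_tac.
    assert (H2 : 0 < / 2) by lra.
    pose proof (bigO_small F mu Hmu _ _ _ H H2) as H3.
    eventually Hnu H3. intros t [H3 H4] H5. nra. }
  assert (Oinu : bigO F mu 0 (fun t => / nu t)) by (refine (bigO_inv F mu nu _ _ Hnu2); lra).
  (* Completing the square: [nu^2] is [(K / sE^2) (1 + 2 s mu^2)] up to order 4, and [1 + 2 s mu^2]
     differs from [(1 + s mu^2)^2] by [s^2 mu^4]. *)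
  assert (Onu4 : bigO F mu 4 (fun t => nu t - kap t / sE t * (1 + s t * mu t ^ 2))).
  { assert (H2 : 0 < / 2) by lra.
    apply (bigO_sqr_cancel F mu 4 nu _ _ H2 Hnu2).
    - assert (bigO F mu 2 (fun t => s t * mu t ^ 2)) by bigO_tac.
      pose proof (bigO_small F mu Hmu _ _ _ H Rlt_0_1) as H3.
      eventually Hkap HsE H3.
      intros t [H4 _] [H5 _] H6. apply Rmult_le_pos; [apply Rdiv_le_0_compat|]; lra.
    - apply (bigO_ext F mu 4 (fun t => mu t ^ 4 *
        (K t * q t - 2 * al ^ 2 * K t - K t * s t ^ 2 * (/ sE t) ^ 2))).
      + eventually Hkap HsE Hb Hnu.
        intros t [H3 H4] [H5 _] H6 [_ H7]. rewrite H7, H6, <- H4. field. lra.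
      + bigO_tac. }
  assert (OY2 : bigO F mu 4 (fun t => Y2 t - nu t)).
  { assert (H : bigO F mu 4 (fun t => al ^ 2 * K t * mu t ^ 4 / nu t)) by bigO_tac.
    destruct H as [C HC]. exists C.
    eventually HY2 HC.
    intros t H1 H2. rewrite Rabs_pos_eq by lra.
    eapply Rle_trans; [|apply H2]. eapply Rle_trans; [|apply Rle_abs]. lra. }
  assert (OY3 : bigO F mu 4 (fun t => Y3 t - Y2 t - kap t * (1 / sE t ^ 2 - 1 / sE t
                     + mu t ^ 2 * ((2 - s t / 2) * (1 / sE t - 1))))).
  { assert (H : bigO F mu 4 (fun t => 88 * kap t / sE t * mu t ^ 4)) by bigO_tac.
    destruct H as [C HC]. exists C.
    eventually HY3 HC.
    intros t H1 H2. eapply Rle_trans; [|apply H2]. eapply Rle_trans; [|apply Rle_abs]. lra. }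
  split.
  - apply (bigO_ext F mu 2 (fun t => ((Y2 t - nu t)
      + (nu t - kap t / sE t * (1 + s t * mu t ^ 2))) * (sE t / kap t) + s t * mu t ^ 2)).
    + eventually Hkap HsE.
      intros t [H1 _] [H2 _]. field. lra.
    + bigO_tac.
  - apply (bigO_ext F mu 4 (fun t => kap t * ((Y2 t - nu t)
      + (nu t - kap t / sE t * (1 + s t * mu t ^ 2))
      + (Y3 t - Y2 t - kap t * (1 / sE t ^ 2 - 1 / sE t
                     + mu t ^ 2 * ((2 - s t / 2) * (1 / sE t - 1))))))).
    + eventually Hkap HsE HKs.
      intros t [H1 H2] [H3 _] H4.
      (* The identity for the coefficient of [x^3] turns [K / sE^2] into [1 - K s mu^2 / 2] exactly,
         which also removes the part of the radial term without [1 / sE] that depends on [s]. *)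
      assert (H5 : K t * (s t * mu t ^ 2 + 2 / sE t ^ 2) / 2 = 1) by (rewrite H4; field).
      replace (1 + K t * mu t ^ 2 * ((2 + s t / 2) / sE t - 2))
        with (K t * (s t * mu t ^ 2 + 2 / sE t ^ 2) / 2
              + K t * mu t ^ 2 * ((2 + s t / 2) / sE t - 2)) by (now rewrite H5).
      rewrite <- H2. field. lra.
    + bigO_tac.
Qed.

(** The leading term is [K mu^2 / (2 W^2)] with [W = kap Y3], so [W] must be known as [1 + z] up to
    order 4. The terms with [mu^4] need [V] and [W] only up to order 2, and the spin term needs [L]
    only up to order 1. *)
Lemma energy_expansion {T : Type} (F : (T -> Prop) -> Prop) {FF : Filter F}
  (mu be e eps L K kap sE s Y2 Y3 : T -> R) (al e1 : R) :
  to_zero F mu -> 0 < e1 < 1 ->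
  F (fun t => -1 < be t < 1) -> F (fun t => 0 < e t < e1) ->
  bigO F mu 2 (fun t => 1 - eps t) ->
  F (fun t => K t * mu t ^ 2 = 1 - eps t ^ 2) ->
  bigO F mu 1 (fun t => L t - 1) ->
  bigO F mu 2 (fun t => K t - (1 - e t ^ 2)) ->
  bigO F mu 2 (fun t => s t - (2 - 4 * al * be t * mu t)) ->
  F (fun t => 0 < kap t /\ kap t ^ 2 = K t) ->
  F (fun t => 0 < sE t /\ sE t ^ 2 = 1 - e t ^ 2) ->
  bigO F mu 2 (fun t => Y2 t * sE t / kap t - 1) ->
  bigO F mu 4 (fun t => kap t * Y3 t - (1 + K t * mu t ^ 2 * ((2 + s t / 2) / sE t - 2))) ->
  bigO F mu 6 (fun t => eps t - (1 - mu t ^ 2 / (2 * Y3 t ^ 2)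
    - 3 * mu t ^ 4 / (Y2 t * Y3 t ^ 3) + 15 * mu t ^ 4 / (8 * Y3 t ^ 4)
    + 2 * al * (be t * L t + al * eps t * mu t) * mu t ^ 5 / (Y2 t ^ 3 * Y3 t ^ 3))).
Proof.
  intros Hmu He1 Hbe He Oeps Hk OL OK Os Hkap HsE OV OW.
  assert (HE1 : 0 < 1 - e1 ^ 2 < 1) by nra.
  assert (Obe : bigO F mu 0 be).
  { apply (bigO_bounded F mu be 1). eventually Hbe He Hkap HsE. intros. apply Rabs_le. lra. }
  assert (Oe : bigO F mu 0 e).
  { apply (bigO_bounded F mu e 1). eventually Hbe He Hkap HsE. intros. apply Rabs_le. lra. }
  assert (HsEc : F (fun t => 1 - e1 ^ 2 <= sE t)).
  { eventually He HsE. intros t H1 [H2 H3]. nra. }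
  assert (OsE : bigO F mu 0 sE).
  { apply (bigO_bounded F mu sE 1). eventually He HsE. intros t H1 H2. apply Rabs_le. nra. }
  assert (OisE : bigO F mu 0 (fun t => / sE t)) by exact (bigO_inv F mu sE _ (proj1 HE1) HsEc).
  assert (OK0 : bigO F mu 0 K).
  { apply (bigO_ext F mu 0 (fun t => (K t - (1 - e t ^ 2)) + (1 - e t ^ 2))).
    - apply filter_forall. intros. ring.
    - bigO_tac. }
  assert (Os0 : bigO F mu 0 s).
  { apply (bigO_ext F mu 0 (fun t => (s t - (2 - 4 * al * be t * mu t)) + (2 - 4 * al * be t * mu t))).
    - apply filter_forall. intros. ring.
    - bigO_tac. }
  set (V t := Y2 t * sE t / kap t) in *.
  set (W t := kap t * Y3 t) in *.
  set (z t := K t * mu t ^ 2 * ((2 + s t / 2) / sE t - 2)).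
  assert (Oz : bigO F mu 2 z) by (unfold z; bigO_tac).
  change (bigO F mu 4 (fun t => W t - (1 + z t))) in OW.
  assert (OW1 : bigO F mu 2 (fun t => W t - 1)).
  { apply (bigO_ext F mu 2 (fun t => (W t - (1 + z t)) + z t)).
    - apply filter_forall. intros. ring.
    - bigO_tac. }
  assert (H2 : 0 < / 2) by lra.
  assert (HV : F (fun t => / 2 <= V t)).
  { pose proof (bigO_small F mu Hmu _ _ _ OV H2) as H.
    eventually H. intros t H. simpl in H. fold (V t) in H. lra. }
  assert (HW : F (fun t => / 2 <= W t)).
  { pose proof (bigO_small F mu Hmu _ _ _ OW1 H2) as H.
    eventually H. intros t H. lra. }
  assert (OiV : bigO F mu 0 (fun t => / V t)) by exact (bigO_inv F mu V _ H2 HV).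
  assert (OiW : bigO F mu 0 (fun t => / W t)) by exact (bigO_inv F mu W _ H2 HW).
  assert (OV1 : bigO F mu 2 (fun t => V t - 1)) by exact OV.
  clear OV.
  assert (OiV1 : bigO F mu 2 (fun t => / V t - 1)).
  { apply (bigO_ext F mu 2 (fun t => - ((V t - 1) * / V t))).
    - eventually HV. intros t H. field. lra.
    - bigO_tac. }
  assert (OiW1 : bigO F mu 2 (fun t => / W t - 1)).
  { apply (bigO_ext F mu 2 (fun t => - ((W t - 1) * / W t))).
    - eventually HW. intros t H. field. lra.
    - bigO_tac. }
  assert (OiWz : bigO F mu 4 (fun t => / W t - (1 - z t))).
  { apply (bigO_ext F mu 4 (fun t => (z t * z t - (W t - (1 + z t)) * (1 - z t)) * / W t)).
    - eventually HW. intros t H. field. lra.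
    - bigO_tac. }
  (* The groups, each of order at least 6, are: the exact remainder of [eps = 1 - k / 2 - k^2 / 8];
     that of [1 / W^2]; the replacement of [V] and [W] by [1] and of [j1 mu] by [be]; the rest.
     Multiples of [K^2 mu^4] cancel because [- 1/8 + 2 - 15/8 = 0]; the others cancel once [K]
     becomes [1 - e^2] and [s] becomes [2 - 4 al be mu], whose [al] part balances the spin term. *)
  apply (bigO_ext F mu 6 (fun t =>
     - (1 - eps t) ^ 3 / 2 + (1 - eps t) ^ 4 / 8
     + mu t ^ 2 * K t / 2 * ((/ W t - (1 - z t)) * (/ W t + 1 - z t) + z t * z t)
     + 3 * mu t ^ 4 * K t * sE t * ((/ V t - 1) * (/ W t) ^ 3
          + (/ W t - 1) * ((/ W t) ^ 2 + / W t + 1))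
     - 15 / 8 * mu t ^ 4 * K t ^ 2 * ((/ W t - 1) * ((/ W t) ^ 3 + (/ W t) ^ 2 + / W t + 1))
     - 2 * al * mu t ^ 5 * sE t ^ 3 *
         ((be t * (L t - 1) + al * (1 - (1 - eps t)) * mu t) * (/ V t) ^ 3 * (/ W t) ^ 3
          + be t * ((/ V t - 1) * ((/ V t) ^ 2 + / V t + 1) * (/ W t) ^ 3
                    + (/ W t - 1) * ((/ W t) ^ 2 + / W t + 1)))
     + mu t ^ 4 * (- (K t - (1 - e t ^ 2)) * (K t + (1 - e t ^ 2)) * (2 + s t / 2) / sE t
          - sE t ^ 3 * (s t - (2 - 4 * al * be t * mu t)) / 2
          + 3 * (K t - (1 - e t ^ 2)) * sE t))).
  - eventually Hk Hkap HsE HV HW. intros t Hkt [Hkp HkK] [HsE0 HsE2] HVt HWt.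
    assert (HY2 : Y2 t = kap t * V t / sE t) by (unfold V; field; lra).
    assert (HY3 : Y3 t = W t / kap t) by (unfold W; field; lra).
    rewrite HY2, HY3.
    assert (Heps : eps t = 1 - K t * mu t ^ 2 / 2 - (K t * mu t ^ 2) ^ 2 / 8
                           - (1 - eps t) ^ 3 / 2 + (1 - eps t) ^ 4 / 8)
      by (rewrite Hkt; field).
    apply Rminus_diag_uniq.
    transitivity (1 - K t * mu t ^ 2 / 2 - (K t * mu t ^ 2) ^ 2 / 8
                           - (1 - eps t) ^ 3 / 2 + (1 - eps t) ^ 4 / 8 - eps t); [|lra].
    rewrite <- HsE2. unfold z. rewrite <- HkK. clear Heps HY2 HY3 Hkt HkK.
    revert HVt HWt. generalize (V t) (W t). intros v w Hv Hw.
    field. lra.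
  - unfold Rdiv. bigO_tac.
Qed.

(** * Orbits for small [mu] *)

Lemma orbit_lam_eps_of (al be p e : R) :
  E_set al be p e -> orbit al be p e (lam_of al be p e) (eps_of al be p e).
Proof.
  intros [lam [eps H]]. unfold lam_of, eps_of, lam_eps. apply epsilon_spec.
  now exists (lam, eps).
Qed.

Lemma orbit_scaled_relations (al be e m lam eps : R) :
  let L := lam * m in
  let b := radial_B al be lam eps * m ^ 2 in
  let K := (1 - eps ^ 2) / m ^ 2 in
  0 <= al < 1 -> 0 < m -> m ^ 2 <= / 20 -> orbit al be (/ m ^ 2) e lam eps ->
  (-1 < be < 1 /\ 0 < e < 1) /\
  (0 < L /\ L ^ 2 <= 6) /\
  (1 - 6 * m ^ 2 <= eps < 1 /\ 0 < 1 - eps ^ 2) /\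
  b = L ^ 2 + al ^ 2 * m ^ 2 + 2 * al * be * eps * L * m /\
  b = 1 + L ^ 2 * m ^ 2 * (3 + e ^ 2)
      - 2 * (al ^ 2 * (1 - be ^ 2) * L ^ 2) * m ^ 4 * (1 + e ^ 2) /\
  K = (1 - e ^ 2) * (b - 4 * L ^ 2 * m ^ 2 + al ^ 2 * (1 - be ^ 2) * L ^ 2 * m ^ 4 * (3 + e ^ 2)).
Proof.
  intros L b K Hal Hm Hm20 Horb.
  destruct (orbit_facts _ _ _ _ _ _ Horb) as [Hbe [Hlam [Heps [Hp [He [Hx [Hw1 Hw2]]]]]]].
  assert (Hm2 : 0 < m ^ 2) by nra.
  assert (Hpm : / m ^ 2 * m ^ 2 = 1) by (field; lra).
  assert (Hx1m : / m ^ 2 / (1 + e) * (m ^ 2 * (1 + e)) = 1) by (field; lra).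
  pose proof (w_level_root _ _ _ _ _ Hal (proj1 Hx) Hw1) as HR1.
  pose proof (w_level_root _ _ _ _ _ Hal (Rlt_trans _ _ _ (proj1 Hx) (proj2 Hx)) Hw2) as HR2.
  destruct (radial_root_relations al be lam eps m e Hm He HR1 HR2) as [HB Hk].
  set (x1 := / m ^ 2 / (1 + e)) in *.
  (* As [1 + e < 2], the bound [/ 20] on [m^2] puts [x1] beyond [10]; the same factor turns [3 / x1]
     into at most [6 m^2]. *)
  assert (Hx10 : 10 <= x1).
  { apply (Rmult_le_reg_r (m ^ 2 * (1 + e))); nra. }
  destruct (w_level_bounds al be lam eps x1 Hal Hbe Hlam Hx10 Hw1 Heps) as [Hl He2].
  assert (H3 : 3 / x1 = 3 * (m ^ 2 * (1 + e))).
  { apply (Rmult_eq_reg_r x1); [|lra].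
    transitivity 3; [field|]; lra. }
  assert (He6 : 1 - 6 * m ^ 2 <= eps) by (rewrite H3 in He2; nra).
  split; [lra|]. split; [|split; [|split; [|split]]].
  - split; [unfold L; nra|].
    replace (L ^ 2) with (lam ^ 2 * m ^ 2) by (unfold L; ring).
    assert (x1 * m ^ 2 <= 1) by nra. nra.
  - split; [lra|nra].
  - unfold b, L, radial_B. ring.
  - unfold b, L. rewrite HB. ring.
  - unfold K. rewrite Hk. unfold b, L. field. lra.
Qed.

Lemma polar_scaled_bounds (al be m lam eps : R) :
  let lamz := be * lam + al * eps in
  let K := (1 - eps ^ 2) / m ^ 2 in
  let N := lam ^ 2 + 2 * al * eps * lamz - al ^ 2 in
  0 < m -> 0 < 1 - eps ^ 2 -> -1 < be < 1 -> 0 < lam -> lamz <> 0 -> 0 < N ->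
  let nu := sqrt N * m in
  let Y2 := (Rabs lamz + polar_action al lam eps lamz) * m in
  nu <= Y2 <= nu + al ^ 2 * K * m ^ 4 / nu.
Proof.
  intros lamz K N Hm Heps Hbe Hlam Hz HN nu Y2.
  assert (Hbl : (lamz - al * eps) ^ 2 < lam ^ 2).
  { unfold lamz. replace (be * lam + al * eps - al * eps) with (be * lam) by ring.
    rewrite Rpow_mult_distr. assert (be ^ 2 < 1) by nra. assert (0 < lam ^ 2) by nra. nra. }
  destruct (polar_action_bounds al lam eps lamz ltac:(lra) Hz Hbl HN) as [H1 H2].
  fold N in H1, H2. pose proof (sqrt_lt_R0 N HN) as HS.
  replace (al ^ 2 * K * m ^ 4 / nu) with (al ^ 2 * (1 - eps ^ 2) / sqrt N * m)
    by (unfold K, nu; field; lra).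
  unfold nu, Y2. nra.
Qed.

Lemma radial_scaled_bound (al be e m lam eps q s : R) :
  let K := (1 - eps ^ 2) / m ^ 2 in
  let kap := sqrt K in
  let sE := sqrt (1 - e ^ 2) in
  0 <= al < 1 -> 0 < m -> m ^ 2 <= / 20 -> 0 < e < 1 -> 0 < 1 - eps ^ 2 ->
  Rabs s <= 3 -> Rabs q <= 2 ->
  (forall x, radial_R al be lam eps x
     = (1 - eps ^ 2) * ((/ m ^ 2 / (1 - e) - x) * (x - / m ^ 2 / (1 + e))) * (x ^ 2 - s * x + q)) ->
  Rabs (radial_action al be lam eps (/ m ^ 2 / (1 + e)) (/ m ^ 2 / (1 - e)) * m
        - kap * (1 / sE ^ 2 - 1 / sE + m ^ 2 * ((2 - s / 2) * (1 / sE - 1))))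
  <= 88 * kap / sE * m ^ 4.
Proof.
  intros K kap sE Hal Hm Hm20 He Hk Hs Hq HR.
  assert (Hm2 : 0 < m ^ 2) by nra.
  assert (HE : 0 < 1 - e ^ 2 < 1) by nra.
  assert (HsE : 0 < sE) by (apply sqrt_lt_R0; lra).
  assert (HsE2 : sE ^ 2 = 1 - e ^ 2) by (apply pow2_sqrt; lra).
  assert (HK : 0 < K) by (apply Rdiv_lt_0_compat; lra).
  assert (Hkap : 0 < kap) by (apply sqrt_lt_R0; lra).
  assert (Hsk : sqrt (1 - eps ^ 2) = kap * m).
  { replace (1 - eps ^ 2) with (K * m ^ 2) by (unfold K; field; lra).
    rewrite sqrt_mult, sqrt_pow2 by lra. reflexivity. }
  set (x1 := / m ^ 2 / (1 + e)) in *. set (x2 := / m ^ 2 / (1 - e)) in *.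
  assert (Hx1m : x1 * (m ^ 2 * (1 + e)) = 1) by (unfold x1; field; lra).
  assert (Hx2m : x2 * (m ^ 2 * (1 - e)) = 1) by (unfold x2; field; lra).
  assert (Hx10 : 10 <= x1) by (apply (Rmult_le_reg_r (m ^ 2 * (1 + e))); nra).
  assert (Hx12 : x1 < x2).
  { apply Rmult_lt_compat_l; [now apply Rinv_0_lt_compat|]. apply Rinv_lt_contravar; nra. }
  (* The semi-axes are [1 / (m^2 sE^2)] and [g], with ratio [1 / sE]. *)
  set (g := / (m ^ 2 * sE)).
  assert (Hg : 0 < g) by (apply Rinv_0_lt_compat; nra).
  assert (Hg2 : g ^ 2 = x1 * x2).
  { replace (g ^ 2) with (/ (m ^ 4 * sE ^ 2)) by (unfold g; field; lra).
    rewrite HsE2. unfold x1, x2. field. repeat split; nra. }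
  pose proof (radial_action_approx al be lam eps x1 x2 (1 - eps ^ 2) s q g
    ltac:(lra) ltac:(lra) ltac:(lra) Hs Hq Hg Hg2 HR) as H.
  rewrite Hsk in H.
  set (I := radial_action al be lam eps x1 x2) in *.
  replace ((x1 + x2) / 2) with (/ (m ^ 2 * sE ^ 2)) in H
    by (rewrite HsE2; unfold x1, x2; field; repeat split; nra).
  assert (Hcg : / (m ^ 2 * sE ^ 2) / g = / sE) by (unfold g; field; lra).
  rewrite Hcg in H.
  replace (I * m - kap * (1 / sE ^ 2 - 1 / sE + m ^ 2 * ((2 - s / 2) * (1 / sE - 1))))
    with ((I - kap * m * (/ (m ^ 2 * sE ^ 2) - g + (2 - s / 2) * (/ sE - 1))) * m)
    by (unfold g; field; lra).
  rewrite Rabs_mult, (Rabs_pos_eq m) by lra.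
  eapply Rle_trans; [apply Rmult_le_compat_r; [lra | exact H]|].
  replace (44 * (kap * m) * (/ sE - 1) / x1 * m)
    with (44 * kap * (/ sE - 1) * (m ^ 4 * (1 + e))) by (unfold x1; field; lra).
  (* [1 + e <= 2] doubles [44] to [88]. *)
  replace (88 * kap / sE * m ^ 4) with (44 * kap * / sE * (m ^ 4 * 2)) by (field; lra).
  assert (1 <= / sE) by (rewrite <- Rinv_1; apply Rinv_le_contravar; nra).
  assert (0 < m ^ 4) by nra.
  apply Rmult_le_compat; nra.
Qed.

(** * The uniform limit and the final estimate *)

Definition energy_series (al j1 j2 j3 : R) : R :=
  1 - 1 / (2 * j3 ^ 2) - 3 / (j2 * j3 ^ 3) + 15 / (8 * j3 ^ 4)
  + 2 * al * j1 / (j2 ^ 3 * j3 ^ 3).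

Lemma energy_series_scaled (al m j1 j2 j3 : R) :
  m <> 0 ->
  energy_series al j1 j2 j3
  = 1 - m ^ 2 / (2 * (j3 * m) ^ 2) - 3 * m ^ 4 / (j2 * m * (j3 * m) ^ 3)
    + 15 * m ^ 4 / (8 * (j3 * m) ^ 4)
    + 2 * al * (j1 * m) * m ^ 5 / ((j2 * m) ^ 3 * (j3 * m) ^ 3).
Proof.
  intros Hm. unfold energy_series, Rdiv.
  rewrite !Rpow_mult_distr, !Rinv_mult.
  (* With the inverses abstracted, the identity is polynomial in them and [m] is the only
     denominator left. *)
  generalize (/ j2) (/ j2 ^ 3) (/ j3 ^ 2) (/ j3 ^ 3) (/ j3 ^ 4). intros. field. exact Hm.
Qed.

(** Neighbourhoods of [mu = 0] inside [D], where [fst (fst t)] is [mu]. One threshold [d] serves all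
    [be] and [e], which encodes uniformity. *)
Definition small_mu_filter (D : R * R * R -> Prop) (P : R * R * R -> Prop) : Prop :=
  exists d, 0 < d /\ forall t, D t -> fst (fst t) < d -> P t.

#[local] Instance small_mu_filter_filter (D : R * R * R -> Prop) : Filter (small_mu_filter D).
Proof.
  split.
  - exists 1. split; [lra | trivial].
  - intros P Q [d1 [Hd1 H1]] [d2 [Hd2 H2]]. exists (Rmin d1 d2).
    split; [now apply Rmin_glb_lt|]. intros t Ht Hd.
    pose proof (Rmin_l d1 d2). pose proof (Rmin_r d1 d2).
    split; [apply H1 | apply H2]; trivial; lra.
  - intros P Q HPQ [d [Hd H]]. exists d. split; [exact Hd | auto].
Qed.

Theorem proposition5 (al be0 be1 e0 e1 mu1 : R)
  (Hal : 0 <= al < 1)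
  (Hbe0 : 0 < be0) (Hbe01 : be0 < be1) (Hbe1 : be1 < 1)
  (He0 : 0 < e0) (He01 : e0 < e1) (He1 : e1 < 1)
  (Hmu1 : 0 < mu1)
  (HJ_defined : forall mu be e,
     J_domain be0 be1 e0 e1 mu1 (mu, be, e) -> E_set al be (/ mu ^ 2) e)
  (HJ_injective : forall q q',
     J_domain be0 be1 e0 e1 mu1 q -> J_domain be0 be1 e0 e1 mu1 q' ->
     J al q = J al q' -> q = q') :
  exists C delta : R, 0 < delta /\
    forall j1 j2 j3 mu be e : R,
      J_domain be0 be1 e0 e1 mu1 (mu, be, e) ->
      (j1, j2, j3) = J al (mu, be, e) ->
      mu < delta ->
      Rabs (eps_of al be (/ mu ^ 2) e
            - (1 - 1 / (2 * j3 ^ 2) - 3 / (j2 * j3 ^ 3) + 15 / (8 * j3 ^ 4)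
               + 2 * al * j1 / (j2 ^ 3 * j3 ^ 3)))
      <= C * mu ^ 6.
Proof.
  set (D := J_domain be0 be1 e0 e1 mu1).
  set (F := small_mu_filter D).
  set (mu := fun t : R * R * R => fst (fst t)).
  set (be := fun t : R * R * R => snd (fst t)).
  set (e := fun t : R * R * R => snd t).
  set (lam := fun t => lam_of al (be t) (/ mu t ^ 2) (e t)).
  set (eps := fun t => eps_of al (be t) (/ mu t ^ 2) (e t)).
  set (L := fun t => lam t * mu t).
  set (b := fun t => radial_B al (be t) (lam t) (eps t) * mu t ^ 2).
  set (K := fun t => (1 - eps t ^ 2) / mu t ^ 2).
  set (q := fun t => al ^ 2 * (1 - be t ^ 2) * L t ^ 2 * (1 - e t ^ 2) / K t).
  set (s := fun t => 2 * L t ^ 2 * (1 - e t ^ 2) / K t - 2 * q t * mu t ^ 2).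
  set (kap := fun t => sqrt (K t)).
  set (sE := fun t => sqrt (1 - e t ^ 2)).
  set (lamz := fun t => be t * lam t + al * eps t).
  set (N := fun t => lam t ^ 2 + 2 * al * eps t * lamz t - al ^ 2).
  set (nu := fun t => sqrt (N t) * mu t).
  set (j2 := fun t => Rabs (lamz t) + polar_action al (lam t) (eps t) (lamz t)).
  set (j3 := fun t => j2 t + radial_action al (be t) (lam t) (eps t)
                              (/ mu t ^ 2 / (1 + e t)) (/ mu t ^ 2 / (1 - e t))).
  assert (HD : F (fun t => D t)) by (exists 1; split; [lra | auto]).
  assert (Hmu : to_zero F mu).
  { intros d Hd. exists d. split; [exact Hd|].
    intros [[m b'] e'] [Hm _] Hlt. unfold mu. simpl in *. lra. }
  assert (He : F (fun t => 0 < e t < e1)).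
  { eventually HD. intros [[m b'] e'] [_ [_ He]]. unfold e. simpl in *. lra. }
  assert (Hbeb : F (fun t => be0 ^ 2 <= be t ^ 2)).
  { eventually HD. intros [[m b'] e'] [_ [Hb _]]. unfold be; simpl fst; simpl snd. destruct Hb; nra. }
  assert (Hrel : F (fun t => 0 < mu t /\
    (-1 < be t < 1 /\ 0 < e t < 1) /\
    (0 < L t /\ L t ^ 2 <= 6) /\
    (1 - 6 * mu t ^ 2 <= eps t < 1 /\ 0 < 1 - eps t ^ 2) /\
    b t = L t ^ 2 + al ^ 2 * mu t ^ 2 + 2 * al * be t * eps t * L t * mu t /\
    b t = 1 + L t ^ 2 * mu t ^ 2 * (3 + e t ^ 2)
        - 2 * (al ^ 2 * (1 - be t ^ 2) * L t ^ 2) * mu t ^ 4 * (1 + e t ^ 2) /\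
    K t = (1 - e t ^ 2) * (b t - 4 * L t ^ 2 * mu t ^ 2
        + al ^ 2 * (1 - be t ^ 2) * L t ^ 2 * mu t ^ 4 * (3 + e t ^ 2)))).
  { pose proof (Hmu (/ 20) ltac:(lra)) as Hmu20. eventually HD Hmu20.
    intros t Ht Hm.
    (* [HJ_defined] makes the values picked by [epsilon] those of a genuine orbit. *)
    assert (Horb : orbit al (be t) (/ mu t ^ 2) (e t) (lam t) (eps t)).
    { apply orbit_lam_eps_of, HJ_defined. destruct t as [[m b'] e']. exact Ht. }
    split; [lra|].
    apply (orbit_scaled_relations al (be t) (e t) (mu t) (lam t) (eps t)); [assumption | lra | nra | exact Horb]. }
  assert (Hm0 : F (fun t => 0 < mu t)) by (eventually Hrel; intros t Ht; apply Ht).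
  assert (Hbe : F (fun t => -1 < be t < 1)) by (eventually Hrel; intros t Ht; apply Ht).
  assert (Heps : F (fun t => 1 - 6 * mu t ^ 2 <= eps t < 1))
    by (eventually Hrel; intros t Ht; apply Ht).
  assert (Hk0 : F (fun t => 0 < 1 - eps t ^ 2))
    by (eventually Hrel; intros t Ht; apply Ht).
  assert (HL : F (fun t => 0 < L t /\ L t ^ 2 <= 6))
    by (eventually Hrel; intros t Ht; apply Ht).
  assert (Hb1 : F (fun t => b t = L t ^ 2 + al ^ 2 * mu t ^ 2 + 2 * al * be t * eps t * L t * mu t))
    by (eventually Hrel; intros t Ht; apply Ht).
  destruct (momentum_expansion F mu be e eps L b K al) as [OL [Oeps [OL1 [OL2 [Ob OK]]]]];
    try assumption.
  { eventually Hrel; intros t Ht; apply Ht. }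
  { eventually Hrel; intros t Ht; apply Ht. }
  { eventually Hrel; intros t Ht; apply Ht. }
  destruct (quadratic_factor_expansion F mu be e L K q s al e1) as [HK [Oq [Hq [Os Hs]]]];
    try assumption; try lra.
  { apply filter_forall. reflexivity. }
  { apply filter_forall. reflexivity. }
  assert (HE1 : 0 < 1 - e1 ^ 2) by nra.
  assert (Hkap : F (fun t => 0 < kap t /\ kap t ^ 2 = K t)).
  { eventually HK. intros t Ht. unfold kap.
    split; [apply sqrt_lt_R0 | apply pow2_sqrt]; lra. }
  assert (HsE : F (fun t => 0 < sE t /\ sE t ^ 2 = 1 - e t ^ 2)).
  { eventually He. intros t Ht. unfold sE.
    split; [apply sqrt_lt_R0 | apply pow2_sqrt]; nra. }
  assert (Hfac : F (fun t =>
    (forall x, radial_R al (be t) (lam t) (eps t) x = (1 - eps t ^ 2) *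
       ((/ mu t ^ 2 / (1 - e t) - x) * (x - / mu t ^ 2 / (1 + e t))) * (x ^ 2 - s t * x + q t)) /\
    K t * (s t * mu t ^ 2 + 2 / sE t ^ 2) = 2 /\
    b t = K t * (1 / sE t ^ 2 + 2 * s t * mu t ^ 2 / sE t ^ 2 + q t * mu t ^ 4))).
  { eventually Hrel HsE.
    intros t [Hm [[_ Het] [_ [[_ Hk] [_ [Hb HKt]]]]]] [_ HsEt].
    assert (Hm2 : 0 < mu t ^ 2) by nra.
    destruct (radial_R_factor al (be t) (lam t) (eps t) (mu t) (e t) Hm Het Hk) as [H1 [H2 H3]].
    { fold (b t). rewrite Hb. unfold L. ring. }
    { replace (1 - eps t ^ 2) with (K t * mu t ^ 2) by (unfold K; field; lra).
      rewrite HKt. unfold b, L. ring. }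
    assert (Hqt : al ^ 2 * (1 - be t ^ 2) * lam t ^ 2 * (1 - e t ^ 2) * mu t ^ 4 / (1 - eps t ^ 2) = q t).
    { unfold q, K, L. field. lra. }
    rewrite Hqt in H1, H2, H3.
    assert (Hst : 2 * lam t ^ 2 * (1 - e t ^ 2) * mu t ^ 4 / (1 - eps t ^ 2) - 2 * q t * mu t ^ 2 = s t).
    { unfold s, K, L. field. lra. }
    rewrite Hst in H1, H2, H3.
    split; [exact H1|]. rewrite HsEt. split.
    - rewrite <- H2 at 2. unfold K. field. split; nra.
    - unfold b. rewrite H3. unfold K. field. split; nra. }
  assert (HN : F (fun t => 0 < N t /\ nu t ^ 2 = b t - 2 * al ^ 2 * K t * mu t ^ 4)).
  { assert (OK0 : bigO F mu 0 K).
    { assert (bigO F mu 0 e).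
      { apply (bigO_bounded F mu e 1). eventually He. intros. apply Rabs_le. lra. }
      apply (bigO_ext F mu 0 (fun t => (K t - (1 - e t ^ 2)) + (1 - e t ^ 2))).
      - apply filter_forall. intros. ring.
      - bigO_tac. }
    assert (O1 : bigO F mu 2 (fun t => (b t - 1) - 2 * al ^ 2 * K t * mu t ^ 4)) by bigO_tac.
    pose proof (bigO_small F mu Hmu _ _ _ O1 Rlt_0_1) as H.
    eventually Hm0 H. intros t Hm H.
    (* The polar and radial coefficients are related by [N = B - 2 al^2 (1 - eps^2)]; after scaling
       the difference is of order 4. *)
    assert (HNm : N t * mu t ^ 2 = b t - 2 * al ^ 2 * K t * mu t ^ 4).
    { unfold N, b, K, lamz, radial_B. field. lra. }
    assert (HN : 0 < N t) by (apply (Rmult_lt_reg_r (mu t ^ 2)); nra).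
    split; [exact HN|]. rewrite <- HNm. unfold nu. rewrite Rpow_mult_distr, pow2_sqrt; lra. }
  assert (HlamZ : F (fun t => lamz t <> 0)).
  (* If [lamz = 0], then [be L = - al eps mu], so [(be L)^2 <= mu^2]. But [L > 1 / 2] makes the left
     side exceed [be0^2 / 4], contradicting [mu < be0 / 2]. *)
  { pose proof (Hmu (be0 / 2) ltac:(lra)) as Hm. pose proof (bigO_small F mu Hmu _ _ (/ 2) OL1 ltac:(lra)) as H.
    eventually Hbeb Heps Hk0 Hm H. intros t Hb Hep Hk Hm HLt Hz.
    assert (HzL : be t * L t = - (al * eps t * mu t)).
    { unfold L, lamz in *. replace (be t * (lam t * mu t)) with (be t * lam t * mu t) by ring.
      replace (be t * lam t) with (- (al * eps t)) by lra. ring. }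
    assert (Hsq : (be t * L t) ^ 2 = (al * eps t) ^ 2 * mu t ^ 2) by (rewrite HzL; ring).
    rewrite Rpow_mult_distr in Hsq.
    assert (Hae : (al * eps t) ^ 2 <= 1).
    { rewrite Rpow_mult_distr. assert (0 <= al ^ 2 <= 1) by nra. assert (0 <= eps t ^ 2 <= 1) by nra. nra. }
    assert (be0 ^ 2 * / 4 < be t ^ 2 * L t ^ 2).
    { assert (/ 4 < L t ^ 2) by nra. assert (0 < be0 ^ 2) by nra. nra. }
    assert (mu t ^ 2 <= be0 ^ 2 * / 4) by nra. nra. }
  assert (HY2 : F (fun t => nu t <= j2 t * mu t <= nu t + al ^ 2 * K t * mu t ^ 4 / nu t)).
  { eventually Hm0 Hbe Hk0 HL HN HlamZ. intros t Hm Hb Hk [HLt _] [HNt _] Hz.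
    apply polar_scaled_bounds; try assumption.
    apply (Rmult_lt_reg_r (mu t)); [exact Hm|]. fold (L t). lra. }
  assert (HY3 : F (fun t => Rabs (j3 t * mu t - j2 t * mu t - kap t * (1 / sE t ^ 2 - 1 / sE t
                     + mu t ^ 2 * ((2 - s t / 2) * (1 / sE t - 1))))
              <= 88 * kap t / sE t * mu t ^ 4)).
  { pose proof (Hmu (/ 20) ltac:(lra)) as Hm.
    eventually He Hk0 Hq Hs Hfac Hm. intros t Het Hk Hqt Hst [HR _] Hm.
    replace (j3 t * mu t - j2 t * mu t) with
      (radial_action al (be t) (lam t) (eps t) (/ mu t ^ 2 / (1 + e t)) (/ mu t ^ 2 / (1 - e t)) * mu t)
      by (unfold j3; ring).
    apply (radial_scaled_bound al (be t) (e t) (mu t) (lam t) (eps t) (q t) (s t)); try assumption; nra. }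
  destruct (action_expansion F mu e b K kap sE q s nu (fun t => j2 t * mu t) (fun t => j3 t * mu t) al e1)
    as [OV OW]; try assumption; try lra.
  { eventually Hfac. intros t H. apply H. }
  { eventually Hfac. intros t H. apply H. }
  { eventually Hm0 HN. intros t Hm [_ H].
    split; [|exact H]. apply Rmult_le_pos; [apply sqrt_pos | lra]. }
  (* Over this filter [bigO] unfolds to exactly the constant and the threshold that the theorem asks
     for. *)
  destruct (energy_expansion F mu be e eps L K kap sE s (fun t => j2 t * mu t) (fun t => j3 t * mu t) al e1)
    as [C [d [Hd HC]]]; try assumption; try lra.
  { eventually Hm0. intros t Hm. unfold K. field. lra. }
  exists C, d. split; [exact Hd|].
  intros j1' j2' j3' m b' e' HDt HJ Hlt.
  specialize (HC (m, b', e') HDt Hlt). cbv beta in HC.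
  change ((j1', j2', j3') = (lamz (m, b', e'), j2 (m, b', e'), j3 (m, b', e'))) in HJ.
  injection HJ as -> -> ->.
  set (t := (m, b', e')) in *.
  assert (Hm : mu t <> 0) by (destruct HDt as [Hm _]; unfold mu, t; simpl; lra).
  change (Rabs (eps t - energy_series al (lamz t) (j2 t) (j3 t)) <= C * mu t ^ 6).
  rewrite (energy_series_scaled al (mu t)) by exact Hm.
  replace (lamz t * mu t) with (be t * L t + al * eps t * mu t) by (unfold lamz, L; ring).
  exact HC.
Qed.
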